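(* Let $k$ be a field, $r\ge1$ an integer, and $B=k\langle x,y\rangle/(y^{r+1})$ with $\deg x=\deg y=1$. Then $\operatorname{Ext}^2_{\mathsf{QGr}\,B}$ is identically zero and $\operatorname{Ext}^1_{\mathsf{QGr}\,B}$ is not.
   Context: $\mathsf{QGr}\,B:=\mathsf{Gr}\,B/\mathsf{Fdim}\,B$, where $\mathsf{Gr}\,B$ is the category of $\mathbb{Z}$-graded left $B$-modules (degree-preserving maps) and $\mathsf{Fdim}\,B$ is the Serre subcategory of modules that are unions of their finite dimensional submodules. ''Identically zero'' means $\operatorname{Ext}^2_{\mathsf{QGr}\,B}(\mathcal{M},\mathcal{N})=0$ for all objects $\mathcal{M},\mathcal{N}$. *)

(* Defs.v *)
From HB Require Import structures.
From mathcomp Require Import all_boot all_algebra zify boolp.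
From mathcomp.multinomials Require Import monalg.
From Stdlib Require Import Relation_Operators.

Set Implicit Arguments.
Unset Strict Implicit.
Unset Printing Implicit Defensive.

Import GRing.Theory.
Local Open Scope ring_scope.
Local Open Scope quotient_scope.

(* Morphisms are compared by the equivalence relation [heq], not by [=]. *)
Record category := Category {
  obj :> Type;
  hom : obj -> obj -> Type;
  heq : forall A B, hom A B -> hom A B -> Prop;
  idm : forall A, hom A A;
  compo : forall A B C, hom B C -> hom A B -> hom A C;
  heq_refl : forall A B (f : hom A B), heq f f;
  heq_sym : forall A B (f g : hom A B), heq f g -> heq g f;
  heq_trans : forall A B (f g h : hom A B), heq f g -> heq g h -> heq f h;
  comp_heq : forall A B C (g g' : hom B C) (f f' : hom A B),
    heq g g' -> heq f f' -> heq (compo g f) (compo g' f');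
  compA : forall A B C D (h : hom C D) (g : hom B C) (f : hom A B),
    heq (compo h (compo g f)) (compo (compo h g) f);
  comp1m : forall A B (f : hom A B), heq (compo (idm B) f) f;
  compm1 : forall A B (f : hom A B), heq (compo f (idm A)) f
}.

Section Yoneda.
Variable C : category.
Implicit Types X Y Z M N : C.

Definition zero_obj Z : Prop := forall X,
  (exists f : hom X Z, forall f', heq f f') /\
  (exists g : hom Z X, forall g', heq g g').

Definition zero_mor X Y (f : hom X Y) : Prop :=
  exists Z (g : hom Z Y) (h : hom X Z), zero_obj Z /\ heq f (compo g h).

Definition is_kernel K X Y (i : hom K X) (f : hom X Y) : Prop :=
  zero_mor (compo f i) /\
  forall T (t : hom T X), zero_mor (compo f t) ->
    exists u : hom T K, heq (compo i u) t /\
      forall u', heq (compo i u') t -> heq u u'.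

Definition is_cokernel X Y Q (p : hom Y Q) (f : hom X Y) : Prop :=
  zero_mor (compo p f) /\
  forall T (t : hom Y T), zero_mor (compo t f) ->
    exists u : hom Q T, heq (compo u p) t /\
      forall u', heq (compo u' p) t -> heq u u'.

Record ses X Y := Ses {
  ses_mid : C;
  ses_inj : hom X ses_mid;
  ses_prj : hom ses_mid Y;
  ses_kernel : is_kernel ses_inj ses_prj;
  ses_cokernel : is_cokernel ses_prj ses_inj
}.

Definition ses_mor X Y X' Y' (s : ses X Y) (s' : ses X' Y')
    (a : hom X X') (b : hom Y Y') : Prop :=
  exists e : hom (ses_mid s) (ses_mid s'),
    heq (compo e (ses_inj s)) (compo (ses_inj s') a) /\
    heq (compo (ses_prj s') e) (compo b (ses_prj s)).

(* [yext n M N] consists of the exact sequences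
     0 -> N -> E_n -> ... -> E_0 -> M -> 0,
   presented as the splice of 0 -> N -> E_n -> ... -> E_1 -> K -> 0
   with 0 -> K -> E_0 -> M -> 0. *)
Fixpoint yext (n : nat) M N : Type :=
  match n with
  | 0 => ses N M
  | n'.+1 => {K : C & (yext n' K N * ses K M)%type}
  end.

(* [yext_mor x x' a]: there is a morphism of exact sequences from x to x' that
   is the identity on N and a on the other end. *)
Fixpoint yext_mor (n : nat) M M' N :
    yext n M N -> yext n M' N -> hom M M' -> Prop :=
  match n return yext n M N -> yext n M' N -> hom M M' -> Prop with
  | 0 => fun s s' a => ses_mor s s' (idm N) a
  | n'.+1 => fun x x' a => exists c : hom (tag x) (tag x'),
      yext_mor (tagged x).1 (tagged x').1 c /\
      ses_mor (tagged x).2 (tagged x').2 c a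
  end.

(* Elements of the Yoneda Ext group Ext^n(M, N) and their equality: for n > 0,
   the equivalence relation generated by the morphisms of exact sequences that
   are the identity on both ends. *)
Definition Ext (n : nat) M N : Type :=
  if n is n'.+1 then yext n' M N else hom M N.

Definition Ext_eq (n : nat) M N : Ext n M N -> Ext n M N -> Prop :=
  match n return Ext n M N -> Ext n M N -> Prop with
  | 0 => @heq C M N
  | n'.+1 => clos_refl_sym_trans _ (fun x x' => yext_mor x x' (idm M))
  end.

(* A group is zero if and only if it has a single element; hence the vanishing
   of Ext^n(M, N) is expressed without mentioning the Baer sum. *)
Definition Ext_trivial (n : nat) M N : Prop :=
  forall x x' : Ext n M N, Ext_eq x x'.

Definition Ext_identically_zero (n : nat) : Prop :=
  forall M N, Ext_trivial n M N.

End Yoneda.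

Record fgAlg (k : fieldType) := FgAlg {
  fg_alg :> algType k;
  fg_index : finType;
  fg_gen : fg_index -> fg_alg;
  fg_span : forall b, exists s : seq (k * seq fg_index),
    b = \sum_(p <- s) p.1 *: \prod_(i <- p.2) fg_gen i
}.

(* The component of degree d when the generators are given degree one: the span
   of the words of length d. *)
Definition homog (k : fieldType) (B : fgAlg k) (d : int) (b : B) : Prop :=
  exists2 s : seq (k * seq (fg_index B)), all (fun p => (size p.2)%:Z == d) s &
    b = \sum_(p <- s) p.1 *: \prod_(i <- p.2) fg_gen i.

Section GradedModules.
Variables (k : fieldType) (B : fgAlg k).

Lemma homog_scal (c : k) : homog 0 (c%:A : B).
Proof. by exists [:: (c, [::])] => //; rewrite big_seq1 big_nil. Qed.

Lemma homog_gen i : homog 1 (fg_gen i : B).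
Proof. by exists [:: (1, [:: i])] => //; rewrite !big_seq1 scale1r. Qed.

(* A grading M = \bigoplus_i M_i is given by the family of its projections
   [part i : M -> M_i], so that M_i = {m | part i m = m}. *)
Record grmod := GrMod {
  gr_sort :> lmodType B;
  part : int -> gr_sort -> gr_sort;
  partD : forall i u v, part i (u + v) = part i u + part i v;
  part_part : forall i j v, part i (part j v) = if i == j then part i v else 0;
  part_sum : forall v, exists2 s : seq int, uniq s & v = \sum_(i <- s) part i v;
  partZ : forall d b i v, homog d b -> part (d + i) (b *: v) = b *: part i v
}.

Record is_gsub (M : grmod) (P : M -> Prop) : Prop := {
  gsub0 : P 0;
  gsubD : forall u v, P u -> P v -> P (u + v);
  gsubZ : forall (b : B) u, P u -> P (b *: u);
  gsub_part : forall i u, P u -> P (part i u)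
}.

(* For graded submodules Q <= P of M, [quot_fdim P Q] says that P/Q is in Fdim:
   every element of P/Q lies in a graded submodule S/Q that is spanned over k by
   finitely many vectors. *)
Definition quot_fdim (M : grmod) (P Q : M -> Prop) : Prop :=
  forall m, P m -> exists S : M -> Prop,
    [/\ is_gsub S, forall u, S u -> P u, forall u, Q u -> S u, S m &
        exists (I : finType) (v : I -> M), forall u, S u ->
          exists c : I -> k, Q (u - \sum_i (c i)%:A *: v i)].

Section Words.
Variable M : grmod.
Implicit Types (m u v : M) (w : seq (fg_index B)) (P Q : M -> Prop).

Definition wact w m : M := foldr (fun b v => fg_gen b *: v) m w.

Lemma actD w u v : wact w (u + v) = wact w u + wact w v.
Proof. by elim: w => //= b w ->; rewrite scalerDr. Qed.

Lemma act0 w : wact w 0 = 0 :> M.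
Proof. by elim: w => //= b w ->; rewrite scaler0. Qed.

Lemma act_sum w (I : Type) (s : seq I) (F : I -> M) :
  wact w (\sum_(i <- s) F i) = \sum_(i <- s) wact w (F i).
Proof. by apply: (big_morph (wact w) (actD w) (act0 w)). Qed.

Lemma act_cat w w' m : wact (w ++ w') m = wact w (wact w' m).
Proof. exact: foldr_cat. Qed.

Lemma part0 i : part i 0 = 0 :> M.
Proof. by apply: (addrI (part i 0)); rewrite -partD !addr0. Qed.

Lemma part_bigsum i (I : Type) (s : seq I) (F : I -> M) :
  part i (\sum_(j <- s) F j) = \sum_(j <- s) part i (F j).
Proof. exact: (big_morph (part i) (partD i) (part0 i)). Qed.

Lemma partN i m : part i (- m) = - part i m.
Proof. by apply: (addrI (part i m)); rewrite -partD !subrr part0. Qed.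

Lemma part_scal i (c : k) m : part i (c%:A *: m) = c%:A *: part i m.
Proof. by have := partZ i m (homog_scal c); rewrite add0r. Qed.

Lemma part_act i w m : part ((size w)%:Z + i) (wact w m) = wact w (part i m).
Proof.
elim: w => [|b w IH] /=; first by rewrite add0r.
by rewrite -IH -(partZ _ _ (homog_gen b)) addrA -PoszD add1n.
Qed.

Lemma gsubN P : is_gsub P -> forall u, P u -> P (- u).
Proof. by move=> gP u Pu; rewrite -scaleN1r; apply: gsubZ. Qed.

Lemma gsubB P : is_gsub P -> forall u v, P u -> P v -> P (u - v).
Proof. by move=> gP u v Pu Pv; apply: gsubD => //; apply: gsubN. Qed.

Lemma gsub_sum P (I : Type) (s : seq I) (F : I -> M) : is_gsub P ->
  (forall i, P (F i)) -> P (\sum_(i <- s) F i).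
Proof.
by move=> gP PF; elim/big_ind: _ => //; [apply: gsub0 | apply: gsubD].
Qed.

Lemma gsub_act P w m : is_gsub P -> P m -> P (wact w m).
Proof. by move=> gP Pm; elim: w => //= b w IH; apply: gsubZ. Qed.

Lemma subspace_closedZ P : P 0 -> (forall u v, P u -> P v -> P (u + v)) ->
    (forall (c : k) u, P u -> P (c%:A *: u)) ->
    (forall b u, P u -> P (fg_gen b *: u)) ->
  forall (b : B) u, P u -> P (b *: u).
Proof.
move=> P0 PD Pk Pg b u Pu; have [s ->] := fg_span b.
rewrite scaler_suml; elim/big_ind: _ => // -[c w] _ /=.
rewrite -mulr_algl -scalerA; apply: Pk.
elim: w => [|b' w IH]; first by rewrite big_nil scale1r.
by rewrite big_cons -scalerA; apply: Pg.
Qed.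

Definition tors P Q := forall m, P m ->
  exists n, forall w, size w = n -> Q (wact w m).

Lemma tors_ge Q m n n' : is_gsub Q -> (n <= n')%N ->
  (forall w, size w = n -> Q (wact w m)) ->
  forall w, size w = n' -> Q (wact w m).
Proof.
move=> gQ le_nn' Qn w sw; rewrite -(cat_take_drop (n' - n) w) act_cat.
by apply: gsub_act => //; apply: Qn; rewrite size_drop sw subKn.
Qed.

Lemma fdim_tors P Q : is_gsub P -> is_gsub Q -> quot_fdim P Q -> tors P Q.
Proof.
move=> gP gQ PQ m /PQ[S [gS SP QS Sm [I [v Sv]]]].
have [D hD] : exists D : seq int, forall i j, j \notin D -> part j (v i) = 0.
  have /fin_all_exists[d hd] : forall i, exists s : seq int,
      forall j, j \notin s -> part j (v i) = 0.
    move=> i; have [s _ E] := part_sum (v i); exists s => j js.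
    rewrite E part_bigsum big1_seq // => l /andP[_ ls]; rewrite part_part.
    by case: eqP => // jl; rewrite jl ls in js.
  exists (flatten [seq d i | i <- enum I]) => i j jD; apply: hd.
  apply: contra jD => jd; apply/flatten_mapP; exists i => //.
  by rewrite mem_enum.
have homS j u : j \notin D -> S u -> part j u = u -> Q u.
  move=> jD Su uE; have [c /(gsub_part gQ j)] := Sv _ Su.
  rewrite partD partN uE part_bigsum big1 ?subr0 // => i _.
  by rewrite part_scal hD // scaler0.
have [s _ ms] := part_sum m.
pose n := ((\max_(j <- D) `|j|%N) + (\max_(j <- s) `|j|%N)).+1.
exists n => w sw; rewrite ms act_sum big_seq.
elim/big_ind: _ => [||i si]; [exact: gsub0 | exact: gsubD |].
rewrite -part_act; apply: (@homS ((size w)%:Z + i)).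
- apply/negP => jD; have := @leq_bigmax_seq _ D xpredT absz _ jD isT.
  have := @leq_bigmax_seq _ s xpredT absz _ si isT.
  rewrite sw /n; move: (\max_(j <- D) _)%N (\max_(j <- s) _)%N => a b.
  clear; lia.
- by apply: gsub_part => //; apply: gsub_act.
- by rewrite part_part eqxx.
Qed.

Lemma tors_fdim P Q : is_gsub P -> is_gsub Q -> (forall u, Q u -> P u) ->
  tors P Q -> quot_fdim P Q.
Proof.
move=> gP gQ QP PQ m Pm; have [n Qn] := PQ m Pm; have [D _ mD] := part_sum m.
pose v (i : n.-bseq (fg_index B) * 'I_(size D)) := wact (val i.1) (part D`_i.2 m).
pose S u := exists c : _ -> k, Q (u - \sum_i (c i)%:A *: v i).
have QS u : Q u -> S u.
  exists (fun=> 0); rewrite big1 ?subr0 // => i _.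
  by rewrite scale0r scale0r.
have SD u1 u2 : S u1 -> S u2 -> S (u1 + u2).
  move=> [c1 Q1] [c2 Q2]; exists (fun i => c1 i + c2 i).
  under eq_bigr do rewrite scalerDl scalerDl.
  by rewrite big_split opprD addrACA; apply: gsubD.
have Sk (c : k) u : S u -> S (c%:A *: u).
  move=> [d Qd]; exists (fun i => c * d i).
  have -> : \sum_i (c * d i)%:A *: v i = c%:A *: \sum_i (d i)%:A *: v i.
    rewrite scaler_sumr; apply: eq_bigr => i _.
    by rewrite scalerA mulr_algl scalerA.
  by rewrite -scalerBr; apply: gsubZ.
have Sv i : S (v i).
  exists (fun j => (j == i)%:R); rewrite (bigD1 i) //= eqxx scale1r scale1r.
  rewrite big1 ?addr0 ?subrr; first exact: gsub0.
  by move=> j /negPf->; rewrite scale0r scale0r.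
have S0 : S 0 by apply: QS; apply: gsub0.
have Spush (T : M -> M) : (forall x y, T (x + y) = T x + T y) ->
    (forall (c : k) x, T (c%:A *: x) = c%:A *: T x) ->
    (forall x, Q x -> Q (T x)) -> (forall i, S (T (v i))) ->
    forall u, S u -> S (T u).
  move=> TD Tk TQ Tv u [c Qc]; rewrite -[u](subrK (\sum_i (c i)%:A *: v i)) TD.
  apply: (SD); first by apply: QS; apply: TQ.
  elim/big_rec: _ => [|i x _ Sx].
    by rewrite -[0](scale0r 0) -[X in X *: _](scale0r 1) Tk scale0r scale0r.
  by rewrite TD Tk; apply: SD => //; apply: Sk.
have Sg b u : S u -> S (fg_gen b *: u).
  apply: Spush => [x y|c x|x|[w j]].
  - exact: scalerDr.
  - by rewrite !scalerA mulr_algl mulr_algr.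
  - exact: gsubZ.
  have [lt_wn|ge_wn] := ltnP (size w) n.
    exact: (Sv (Bseq (lt_wn : size (b :: w) <= n)%N, j)).
  have sw : size w = n by apply/eqP; rewrite eqn_leq ge_wn size_bseq.
  apply: QS; apply: (gsubZ gQ); rewrite /v /= -part_act.
  by apply: (gsub_part gQ); apply: Qn.
have gS : is_gsub S.
  split=> //; first exact: subspace_closedZ.
  move=> i; apply: Spush => [x y|c x|x|[w j]].
  - exact: partD.
  - exact: part_scal.
  - exact: gsub_part.
  rewrite /v -part_act part_part; case: eqP => [->|//].
  by rewrite part_act; apply: (Sv (w, j)).
exists S; split=> //.
- move=> u [c /QP Pc]; rewrite -[u](subrK (\sum_i (c i)%:A *: v i)).
  apply: gsubD => //; apply: gsub_sum => // i.
  by apply: gsubZ => //; apply: gsub_act => //; apply: gsub_part.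
- rewrite mD (big_nth 0) big_mkord; elim/big_ind: _ => // j _.
  exact: (Sv ([bseq], j)).
- by exists _, v.
Qed.

Lemma tors_trans P Q R : is_gsub R -> tors P Q -> tors Q R -> tors P R.
Proof.
move=> gR PQ QR m /PQ[n Qn].
have /fin_all_exists[f Rf] : forall t : n.-tuple (fg_index B), exists l,
    forall w, size w = l -> R (wact w (wact t m)).
  by move=> t; apply/QR/Qn; rewrite size_tuple.
exists (\max_t f t + n)%N => w sw; set l := \max_t f t in sw.
rewrite -(cat_take_drop l w) act_cat.
have sd : size (drop l w) == n by rewrite size_drop sw addKn.
have ls : size (take l w) = l by rewrite size_takel // sw leq_addr.
have fl : (f (Tuple sd) <= l)%N by exact: (leq_bigmax (F := f)).
exact: (tors_ge gR fl (Rf (Tuple sd)) ls).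
Qed.

Lemma tors_sub P Q Q' : (forall u, Q u -> Q' u) -> tors P Q -> tors P Q'.
Proof. by move=> QQ' PQ m /PQ[n Qn]; exists n => w /Qn/QQ'. Qed.

Lemma torsI P Q Q' : is_gsub Q -> is_gsub Q' -> tors P Q -> tors P Q' ->
  tors P (fun u => Q u /\ Q' u).
Proof.
move=> gQ gQ' PQ PQ' m Pm; have [n Qn] := PQ m Pm; have [n' Qn'] := PQ' m Pm.
exists (maxn n n') => w sw; split.
  exact: (tors_ge gQ (leq_maxl n n') Qn sw).
exact: (tors_ge gQ' (leq_maxr n n') Qn' sw).
Qed.

End Words.

(* A morphism M -> N of Gr B / Fdim B is represented by a degree-preserving
   B-linear map f : M' -> N/N', where M' <= M and N' <= N are graded submodules
   with M/M' and N' in Fdim.  Such an f is the same thing as its graph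
   {(m, n) | m \in M', f m = n + N'}, a graded submodule of M x N from which
   M' and N' are recovered as [qdom] and [qindet]. *)
Record is_grel (M N : grmod) (G : M -> N -> Prop) : Prop := {
  grel0 : G 0 0;
  grelD : forall m m' n n', G m n -> G m' n' -> G (m + m') (n + n');
  grelZ : forall (b : B) m n, G m n -> G (b *: m) (b *: n);
  grel_part : forall i m n, G m n -> G (part i m) (part i n)
}.

Definition qdom (M N : grmod) (G : M -> N -> Prop) (m : M) := exists n, G m n.
Definition qindet (M N : grmod) (G : M -> N -> Prop) (n : N) := G 0 n.

Record qhom (M N : grmod) := QHom {
  graph :> M -> N -> Prop;
  graph_rel : is_grel graph;
  graph_dom : quot_fdim (fun=> True) (qdom graph);
  graph_indet : quot_fdim (qindet graph) (fun n => n = 0)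
}.

(* Equality in the colimit of the groups Hom(M', N/N'): the two maps induce the
   same map P -> N/Q for some smaller P and larger Q. *)
Definition qeq (M N : grmod) (f g : qhom M N) : Prop :=
  exists (P : M -> Prop) (Q : N -> Prop),
    [/\ is_gsub P /\ is_gsub Q,
        quot_fdim (fun=> True) P /\ quot_fdim Q (fun n => n = 0),
        forall m, P m -> qdom f m /\ qdom g m,
        forall n, qindet f n \/ qindet g n -> Q n &
        forall m n n', P m -> f m n -> g m n' -> Q (n - n')].

Lemma gsubT (M : grmod) : is_gsub (fun _ : M => True).
Proof. by []. Qed.

Lemma gsub_zero (M : grmod) : is_gsub (fun m : M => m = 0).
Proof.
split=> // [u v -> ->|b u ->|i u ->]; first by rewrite addr0.
  by rewrite scaler0.
by rewrite part0.
Qed.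

Section Hom.
Variables M N : grmod.
Implicit Types (G : M -> N -> Prop) (f g h : qhom M N).

Lemma gsub_dom G : is_grel G -> is_gsub (qdom G).
Proof.
move=> gG; split=> [|u v [m Gm] [n Gn]|b u [m Gm]|i u [m Gm]].
- by exists 0; apply: (grel0 gG).
- by exists (m + n); apply: (grelD gG).
- by exists (b *: m); apply: (grelZ gG).
- by exists (part i m); apply: (grel_part gG).
Qed.

Lemma gsub_indet G : is_grel G -> is_gsub (qindet G).
Proof.
move=> gG; split=> [|u v Gu Gv|b u Gu|i u Gu]; rewrite /qindet.
- exact: (grel0 gG).
- by rewrite -[0]addr0; apply: (grelD gG).
- by rewrite -(scaler0 _ b); apply: (grelZ gG).
- by rewrite -(part0 _ i); apply: (grel_part gG).
Qed.

Lemma grelB G : is_grel G -> forall m m' n n',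
  G m n -> G m' n' -> G (m - m') (n - n').
Proof.
move=> gG m m' n n' Gm Gn; apply: (grelD gG) => //.
by rewrite -scaleN1r -[- n']scaleN1r; apply: (grelZ gG).
Qed.

Lemma grel_act G : is_grel G -> forall w m n, G m n -> G (wact w m) (wact w n).
Proof. by move=> gG w m n Gmn; elim: w => //= b w; apply: (grelZ gG). Qed.

Definition mk_qhom G (gG : is_grel G) (dG : tors (fun=> True) (qdom G))
    (iG : tors (qindet G) (fun n => n = 0)) : qhom M N :=
  QHom gG (tors_fdim (@gsubT M) (gsub_dom gG) (fun _ _ => I) dG)
    (tors_fdim (gsub_indet gG) (gsub_zero N)
       (fun u u0 => eq_ind_r (qindet G) (grel0 gG) u0) iG).

Lemma tors_dom f : tors (fun=> True) (qdom f).
Proof. exact: fdim_tors (@gsubT M) (gsub_dom (graph_rel f)) (graph_dom f). Qed.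

Lemma tors_indet f : tors (qindet f) (fun n => n = 0).
Proof.
exact: fdim_tors (gsub_indet (graph_rel f)) (@gsub_zero N) (@graph_indet M N f).
Qed.

Lemma qeqP f g : qeq f g <-> exists (P : M -> Prop) (Q : N -> Prop),
    [/\ is_gsub P /\ is_gsub Q,
        tors (fun=> True) P /\ tors Q (fun n => n = 0),
        forall m, P m -> qdom f m /\ qdom g m,
        forall n, qindet f n \/ qindet g n -> Q n &
        forall m n n', P m -> f m n -> g m n' -> Q (n - n')].
Proof.
split=> -[P [Q [[gP gQ] [tP tQ] Pd Qi E]]]; exists P, Q; split=> //; split.
- exact: fdim_tors (@gsubT M) gP tP.
- exact: fdim_tors gQ (@gsub_zero N) tQ.
- exact: tors_fdim (@gsubT M) gP (fun _ _ => I) tP.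
- by apply: (tors_fdim gQ (@gsub_zero N)) => // u ->; apply: (gsub0 gQ).
Qed.

Lemma sub_qeq f g : (forall m n, f m n -> g m n) -> qeq f g.
Proof.
move=> fg; apply/qeqP; exists (qdom f), (qindet g); split.
- by split; [apply: gsub_dom | apply: gsub_indet]; apply: graph_rel.
- by split; [apply: tors_dom | apply: tors_indet].
- by move=> m [n fmn]; split; exists n => //; apply: fg.
- by move=> n [/fg|].
- move=> m n n' _ /fg gn gn'; rewrite /qindet -(subrr m).
  exact: (grelB (graph_rel g)).
Qed.

Lemma qeq_refl f : qeq f f. Proof. exact: sub_qeq. Qed.

Lemma qeq_sym f g : qeq f g -> qeq g f.
Proof.
move=> [P [Q [[gP gQ] t Pd Qi E]]]; exists P, Q; split=> // [m /Pd[]|n|m n n' Pm gn fn] //.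
  by move=> H; apply: Qi; case: H; [right | left].
by rewrite -opprB; apply: (gsubN gQ); apply: (E m).
Qed.

Lemma qeq_trans f g h : qeq f g -> qeq g h -> qeq f h.
Proof.
move=> /qeqP[P [Q [[gP gQ] [tP tQ] Pd Qi E]]].
move=> /qeqP[P' [Q' [[gP' gQ'] [tP' tQ'] Pd' Qi' E']]]; apply/qeqP.
exists (fun m => P m /\ P' m), (fun n => exists q q', [/\ Q q, Q' q' & n = q + q']).
split.
- split; split.
  + by split; apply: gsub0.
  + by move=> u v [? ?] [? ?]; split; apply: gsubD.
  + by move=> b u [? ?]; split; apply: gsubZ.
  + by move=> i u [? ?]; split; apply: gsub_part.
  + by exists 0, 0; split; rewrite ?addr0 //; apply: gsub0.
  + move=> _ _ [q1 [q1' [? ? ->]]] [q2 [q2' [? ? ->]]].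
    by exists (q1 + q2), (q1' + q2'); split; rewrite 1?addrACA //; apply: gsubD.
  + move=> b _ [q [q' [? ? ->]]].
    by exists (b *: q), (b *: q'); split; rewrite ?scalerDr //; apply: gsubZ.
  + move=> i _ [q [q' [? ? ->]]].
    by exists (part i q), (part i q'); split; rewrite ?partD //; apply: gsub_part.
- split; first exact: torsI.
  move=> _ [q [q' [/tQ[n Hn] /tQ'[n' Hn'] ->]]]; exists (maxn n n') => w sw.
  rewrite actD (tors_ge (@gsub_zero N) (leq_maxl n n') Hn sw).
  by rewrite (tors_ge (@gsub_zero N) (leq_maxr n n') Hn' sw) addr0.
- by move=> m [/Pd[? _] /Pd'[_ ?]].
- move=> n [fn|hn].
    by exists n, 0; split; rewrite ?addr0 //; [apply: Qi; left | apply: gsub0].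
  by exists 0, n; split; rewrite ?add0r //; [apply: gsub0 | apply: Qi'; right].
- move=> m n n' [Pm Pm'] fn hn'; have [_ [l gl]] := Pd m Pm.
  exists (n - l), (l - n'); split; [exact: (E m) | exact: (E' m) |].
  by rewrite addrA subrK.
Qed.

Lemma qeq_zigzag f g : qeq f g -> exists a b h : qhom M N,
  [/\ forall m n, a m n -> f m n, forall m n, a m n -> h m n,
      forall m n, b m n -> g m n & forall m n, b m n -> h m n].
Proof.
move=> /qeqP[P [Q [[gP gQ] [tP tQ] Pd Qi E]]].
pose res (f' : qhom M N) m n := P m /\ f' m n.
have rel_res f' : is_grel (res f').
  have gf := graph_rel f'; split.
  - by split; [apply: gsub0 | apply: (grel0 gf)].
  - by move=> m m' n n' [? ?] [? ?]; split; [apply: gsubD | apply: (grelD gf)].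
  - by move=> b m n [? ?]; split; [apply: gsubZ | apply: (grelZ gf)].
  - by move=> i m n [? ?]; split; [apply: gsub_part | apply: (grel_part gf)].
have dom_res f' : (forall m, P m -> qdom f' m) -> tors (fun=> True) (qdom (res f')).
  by move=> Pf; apply: tors_sub tP => m Pm; have [n fn] := Pf m Pm; exists n.
have ind_res f' : tors (qindet (res f')) (fun n => n = 0).
  by move=> n [_ fn]; apply: (@tors_indet f' n).
pose H m n := P m /\ exists2 q, Q q & f m (n + q).
have gf := graph_rel f.
have gH : is_grel H.
  split.
  - split; first exact: gsub0.
    by exists 0; [apply: gsub0 | rewrite addr0; apply: (grel0 gf)].
  - move=> m m' n n' [? [q Qq fq]] [? [q' Qq' fq']]; split; first exact: gsubD.
    by exists (q + q'); [apply: gsubD | rewrite addrACA; apply: (grelD gf)].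
  - move=> b m n [? [q Qq fq]]; split; first exact: gsubZ.
    by exists (b *: q); [apply: gsubZ | rewrite -scalerDr; apply: (grelZ gf)].
  - move=> i m n [? [q Qq fq]]; split; first exact: gsub_part.
    exists (part i q); first exact: gsub_part.
    by rewrite -partD; apply: (grel_part gf).
have dH : tors (fun=> True) (qdom H).
  apply: tors_sub tP => m Pm; have [[n fn] _] := Pd m Pm.
  by exists n; split=> //; exists 0; [apply: gsub0 | rewrite addr0].
have iH : tors (qindet H) (fun n => n = 0).
  move=> n [_ [q Qq fq]]; apply: tQ; rewrite -[n](addrK q).
  by apply: gsubB => //; apply: Qi; left.
exists (mk_qhom (rel_res f) (dom_res f (fun m Pm => proj1 (Pd m Pm))) (ind_res f)).
exists (mk_qhom (rel_res g) (dom_res g (fun m Pm => proj2 (Pd m Pm))) (ind_res g)).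
exists (mk_qhom gH dH iH); split=> m n /= [Pm Hn] //; split=> //.
  by exists 0; [apply: gsub0 | rewrite addr0].
have [[l fl] _] := Pd m Pm; exists (l - n); first exact: (E m).
by rewrite addrC subrK.
Qed.

End Hom.

Section Composition.

Lemma id_rel (M : grmod) : is_grel (fun m n : M => m = n).
Proof. by split=> // [m m' _ _ <- <-|b m _ <-|i m _ <-]. Qed.

Lemma id_dom (M : grmod) : tors (fun=> True) (qdom (fun m n : M => m = n)).
Proof. by move=> m _; exists 0 => w _; exists (wact w m). Qed.

Lemma id_indet (M : grmod) : tors (qindet (fun m n : M => m = n)) (fun n => n = 0).
Proof. by move=> m <-; exists 0 => w _; rewrite act0. Qed.

Definition qid (M : grmod) : qhom M M :=
  mk_qhom (id_rel M) (@id_dom M) (@id_indet M).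

Variables L M N : grmod.
Variables (g : qhom M N) (f : qhom L M).

Definition comp_graph (l : L) (n : N) : Prop := exists2 m, f l m & g m n.

Lemma comp_rel : is_grel comp_graph.
Proof.
have gf := graph_rel f; have gg := graph_rel g; split.
- by exists 0; [apply: (grel0 gf) | apply: (grel0 gg)].
- move=> l l' n n' [m fm gm] [m' fm' gm']; exists (m + m').
    exact: (grelD gf).
  exact: (grelD gg).
- move=> b l n [m fm gm]; exists (b *: m); first exact: (grelZ gf).
  exact: (grelZ gg).
- move=> i l n [m fm gm]; exists (part i m); first exact: (grel_part gf).
  exact: (grel_part gg).
Qed.

Lemma comp_dom : tors (fun=> True) (qdom comp_graph).
Proof.
apply: (tors_trans (gsub_dom comp_rel) (@tors_dom _ _ f)) => l [m fm].
have [n Hn] := @tors_dom _ _ g m I; exists n => w /Hn[p gp].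
by exists p; exists (wact w m) => //; apply: (grel_act (graph_rel f)).
Qed.

Lemma comp_indet : tors (qindet comp_graph) (fun n => n = 0).
Proof.
apply: (tors_trans (gsub_zero N) _ (@tors_indet _ _ g)) => n [m fm gm].
have [d Hd] := @tors_indet _ _ f m fm; exists d => w /Hd w0.
by rewrite /qindet -w0; apply: (grel_act (graph_rel g)).
Qed.

Definition qcomp : qhom L N := mk_qhom comp_rel comp_dom comp_indet.

End Composition.

Lemma qcomp_qeq (L M N : grmod) (g g' : qhom M N) (f f' : qhom L M) :
  qeq g g' -> qeq f f' -> qeq (qcomp g f) (qcomp g' f').
Proof.
have mono (h h' : qhom M N) (e e' : qhom L M) :
    (forall m n, h m n -> h' m n) -> (forall m n, e m n -> e' m n) ->
    qeq (qcomp h e) (qcomp h' e').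
  by move=> hh ee; apply: sub_qeq => l n [m /ee em /hh hm]; exists m.
move=> /qeq_zigzag[a [b [h [ag ah bg bh]]]] /qeq_zigzag[a' [b' [h' [af ah' bf bh']]]].
apply: (qeq_trans (qeq_sym (mono _ _ _ _ ag af))).
apply: (qeq_trans (mono _ _ _ _ ah ah')).
exact: (qeq_trans (qeq_sym (mono _ _ _ _ bh bh')) (mono _ _ _ _ bg bf)).
Qed.

Lemma qcompA (K L M N : grmod) (h : qhom M N) (g : qhom L M) (f : qhom K L) :
  qeq (qcomp h (qcomp g f)) (qcomp (qcomp h g) f).
Proof.
apply: sub_qeq => k' n [m [l fl gl] hm].
by exists l => //; exists m.
Qed.

Lemma qcomp1m (M N : grmod) (f : qhom M N) : qeq (qcomp (qid N) f) f.
Proof. by apply: sub_qeq => m n [n' fn <-]. Qed.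

Lemma qcompm1 (M N : grmod) (f : qhom M N) : qeq (qcomp f (qid M)) f.
Proof. by apply: sub_qeq => m n [n' <- fn]. Qed.

Definition QGr : category := Category qeq_refl qeq_sym qeq_trans
  qcomp_qeq qcompA qcomp1m qcompm1.

End GradedModules.

Section TwoSidedQuotient.
Variables (k : fieldType) (A : algType k) (g : A).

Definition genIdeal : {pred A} := fun a =>
  `[< exists n (u v : 'I_n -> A), a = \sum_(i < n) u i * g * v i >].

Lemma genIdealP a : reflect (exists n (u v : 'I_n -> A),
  a = \sum_(i < n) u i * g * v i) (a \in genIdeal).
Proof. exact: asboolP. Qed.

Lemma genIdeal0 : 0 \in genIdeal.
Proof.
by apply/genIdealP; exists 0, (fun=> 0), (fun=> 0); rewrite big_ord0.
Qed.

Lemma genIdealD : {in genIdeal &, forall a b, a + b \in genIdeal}.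
Proof.
move=> a b /genIdealP[n [u [v ->]]] /genIdealP[m [u' [v' ->]]].
apply/genIdealP.
pose glue (f : 'I_n -> A) h (i : 'I_(n + m)) :=
  match split i with inl j => f j | inr j => h j end.
exists (n + m)%N, (glue u u'), (glue v v').
rewrite big_split_ord; congr (_ + _); apply: eq_bigr => i _.
  have sl : split (lshift m i) = inl i := unsplitK (inl i).
  by rewrite /glue sl.
have sr : split (rshift n i) = inr i := unsplitK (inr i).
by rewrite /glue sr.
Qed.

Lemma genIdealMl c : {in genIdeal, forall a, c * a \in genIdeal}.
Proof.
move=> a /genIdealP[n [u [v ->]]]; apply/genIdealP.
exists n, (fun i => c * u i), v; rewrite mulr_sumr.
by apply: eq_bigr => i _; rewrite !mulrA.
Qed.

Lemma genIdealMr c : {in genIdeal, forall a, a * c \in genIdeal}.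
Proof.
move=> a /genIdealP[n [u [v ->]]]; apply/genIdealP.
exists n, u, (fun i => v i * c); rewrite mulr_suml.
by apply: eq_bigr => i _; rewrite !mulrA.
Qed.

Lemma genIdeal_zmod : zmod_closed genIdeal.
Proof.
split=> [|a b Ia Ib]; first exact: genIdeal0.
by apply: genIdealD => //; rewrite -mulN1r genIdealMl.
Qed.

HB.instance Definition _ := GRing.isZmodClosed.Build A genIdeal genIdeal_zmod.

Definition ringQuot := {ideal_quot genIdeal}.

HB.instance Definition _ := GRing.Zmodule.on ringQuot.
HB.instance Definition _ := EqQuotient.on ringQuot.

Definition toQuot : A -> ringQuot := \pi.

Lemma toQuot_eq a b : (toQuot a = toQuot b) <-> (a - b \in genIdeal).
Proof. by rewrite /toQuot Quotient.idealrBE; split=> [->|/eqP]. Qed.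

Lemma toQuot_repr b : toQuot (repr b) = b. Proof. exact: reprK. Qed.

Lemma toQuotD a b : toQuot (a + b) = toQuot a + toQuot b.
Proof. by rewrite /toQuot !piE. Qed.

Lemma toQuot0 : toQuot 0 = 0.
Proof. by rewrite /toQuot !piE. Qed.

Definition mulB (b c : ringQuot) := toQuot (repr b * repr c).
Definition scaleB (c : k) (b : ringQuot) := toQuot (c *: repr b).

Lemma repr_toQuot a : repr (toQuot a) - a \in genIdeal.
Proof. by apply/toQuot_eq; rewrite toQuot_repr. Qed.

Lemma toQuotM a b : toQuot (a * b) = mulB (toQuot a) (toQuot b).
Proof.
apply/esym/toQuot_eq.
have -> : repr (toQuot a) * repr (toQuot b) - a * b =
  repr (toQuot a) * (repr (toQuot b) - b) + (repr (toQuot a) - a) * b.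
  by rewrite mulrBr mulrBl addrA subrK.
by apply: genIdealD; [apply: genIdealMl | apply: genIdealMr]; apply: repr_toQuot.
Qed.

Lemma toQuotZ c a : toQuot (c *: a) = scaleB c (toQuot a).
Proof.
apply/esym/toQuot_eq; rewrite -scalerBr -[_ - a]mul1r scalerAl.
exact/genIdealMl/repr_toQuot.
Qed.

Lemma mulBA : associative mulB.
Proof.
move=> a b c; rewrite -[a]toQuot_repr -[b]toQuot_repr -[c]toQuot_repr.
by rewrite -!toQuotM mulrA.
Qed.

Lemma mul1B : left_id (toQuot 1) mulB.
Proof. by move=> a; rewrite -[a]toQuot_repr -!toQuotM mul1r. Qed.

Lemma mulB1 : right_id (toQuot 1) mulB.
Proof. by move=> a; rewrite -[a]toQuot_repr -!toQuotM mulr1. Qed.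

Lemma mulBDl : left_distributive mulB +%R.
Proof.
move=> a b c; rewrite -[a]toQuot_repr -[b]toQuot_repr -[c]toQuot_repr.
by rewrite -toQuotD -!toQuotM -toQuotD mulrDl.
Qed.

Lemma mulBDr : right_distributive mulB +%R.
Proof.
move=> a b c; rewrite -[a]toQuot_repr -[b]toQuot_repr -[c]toQuot_repr.
by rewrite -toQuotD -!toQuotM -toQuotD mulrDr.
Qed.

HB.instance Definition _ :=
  GRing.Zmodule_isPzRing.Build ringQuot mulBA mul1B mulB1 mulBDl mulBDr.

Lemma scaleBA c d a : scaleB c (scaleB d a) = scaleB (c * d) a.
Proof. by rewrite -[a]toQuot_repr -!toQuotZ scalerA. Qed.

Lemma scale1B : left_id 1 scaleB.
Proof. by move=> a; rewrite -[a]toQuot_repr -!toQuotZ scale1r. Qed.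

Lemma scaleBDr : right_distributive scaleB +%R.
Proof.
move=> c a b; rewrite -[a]toQuot_repr -[b]toQuot_repr.
by rewrite -toQuotD -!toQuotZ -toQuotD scalerDr.
Qed.

Lemma scaleBDl a : {morph scaleB^~ a : c d / c + d}.
Proof. by move=> c d; rewrite -[a]toQuot_repr -!toQuotZ -toQuotD scalerDl. Qed.

HB.instance Definition _ :=
  GRing.Zmodule_isLmodule.Build k ringQuot scaleBA scale1B scaleBDr scaleBDl.

Lemma scaleBAl (c : k) (a b : ringQuot) : c *: (a * b) = (c *: a) * b.
Proof.
change (scaleB c (mulB a b) = mulB (scaleB c a) b).
by rewrite -[a]toQuot_repr -[b]toQuot_repr -!(toQuotM, toQuotZ) scalerAl.
Qed.

Lemma scaleBAr (c : k) (a b : ringQuot) : c *: (a * b) = a * (c *: b).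
Proof.
change (scaleB c (mulB a b) = mulB a (scaleB c b)).
by rewrite -[a]toQuot_repr -[b]toQuot_repr -!(toQuotM, toQuotZ) scalerAr.
Qed.

End TwoSidedQuotient.

Lemma malg_scalerAr (R : comNzRingType) (K : monomType) (c : R)
    (u v : {malg R[K]}) :
  c *: (u * v) = u * (c *: v).
Proof.
apply/malgP => w; rewrite mcoeffZ.
rewrite (mcoeffMlw w (finmap.fsubset_refl (msupp u))
                     (finmap.fsubset_refl (msupp v))).
rewrite (mcoeffMlw w (finmap.fsubset_refl (msupp u)) (msuppZ_le c v)).
rewrite mulr_sumr; apply: eq_bigr => i _.
rewrite mulr_sumr; apply: eq_bigr => j _.
by rewrite mcoeffZ mulrnAr mulrCA.
Qed.

(* k<x,y>: the letter [false] stands for x and the letter [true] for y. *)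
Definition freeAlg (k : fieldType) := {malg k[{fmonom bool}]}.

HB.instance Definition _ (k : fieldType) := GRing.Lalgebra.on (freeAlg k).
HB.instance Definition _ (k : fieldType) :=
  GRing.Lalgebra_isAlgebra.Build k (freeAlg k) (@malg_scalerAr k _).

Definition letter (k : fieldType) (b : bool) : freeAlg k := << fmu b >>.

Definition algB (k : fieldType) (r : nat) :=
  ringQuot (letter k true ^+ r.+1).

HB.instance Definition _ (k : fieldType) (r : nat) := GRing.PzRing.on (algB k r).
HB.instance Definition _ (k : fieldType) (r : nat) := GRing.Lmodule.on (algB k r).

Lemma algB_neq0 (k : fieldType) (r : nat) : 1 != 0 :> algB k r.
Proof.
apply/eqP; rewrite -[RHS]toQuot0 => /toQuot_eq.
rewrite subr0 => /genIdealP[n [u [v E]]].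
pose ev (a : freeAlg k) : k := @mcoeff {fmonom bool} k mone a.
have [evM ev1] := @mcoeff1g_is_multiplicative {fmonom bool} k.
have h0 : ev (letter k true) = 0.
  rewrite /ev /letter mcoeffU.
  by case: eqP => // /(congr1 (@fdeg _)); rewrite fdegU fdeg1.
have evD : {morph ev : a b / a + b} by move=> a b; apply: mcoeffD.
have /eqP := congr1 ev E.
rewrite (big_morph ev evD (mcoeff0 _)) big1 => [|i _].
  by rewrite [ev 1]ev1 oner_eq0.
rewrite exprS -!mulrA [ev _]evM [X in _ * X]evM.
by rewrite [X in _ * (X * _)]h0 mul0r mulr0.
Qed.

HB.instance Definition _ (k : fieldType) (r : nat) :=
  GRing.PzSemiRing_isNonZero.Build (algB k r) (@algB_neq0 k r).
HB.instance Definition _ (k : fieldType) (r : nat) :=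
  GRing.Lmodule_isLalgebra.Build k (algB k r) (@scaleBAl k _ _).
HB.instance Definition _ (k : fieldType) (r : nat) :=
  GRing.Lalgebra_isAlgebra.Build k (algB k r) (@scaleBAr k _ _).



Section AlgB.
Variables (k : fieldType) (r : nat).

Definition toB : freeAlg k -> algB k r := @toQuot k _ _.

Lemma toBD a b : toB (a + b) = toB a + toB b. Proof. exact: toQuotD. Qed.
Lemma toB0 : toB 0 = 0. Proof. exact: toQuot0. Qed.
Lemma toBM a b : toB (a * b) = toB a * toB b. Proof. exact: toQuotM. Qed.
Lemma toB1 : toB 1 = 1. Proof. by []. Qed.
Lemma toBZ c a : toB (c *: a) = c *: toB a. Proof. exact: toQuotZ. Qed.

Lemma toB_word (w : {fmonom bool}) :
  toB << w >> = \prod_(b <- (w : seq bool)) toB (letter k b).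
Proof.
case: w => w; elim: w => [|b w IH] /=.
  rewrite big_nil -toB1; congr (toB << _ >>).
  by apply/eqP; rewrite fmP fm1.
rewrite big_cons -IH -toBM; congr (toB _).
rewrite /letter [RHS]malgM_def fgmulUU mulr1; congr (<< _ >>).
by apply/eqP; rewrite fmP fmM fmU.
Qed.

Lemma algB_span (b : algB k r) : exists s : seq (k * seq bool),
  b = \sum_(p <- s) p.1 *: \prod_(i <- p.2) toB (letter k i).
Proof.
pose a : {malg k[{fmonom bool}]} := repr b.
exists [seq (a@_w, fmonom_val w) | w <- finmap.enum_fset (msupp a)].
rewrite big_map -[LHS](toQuot_repr b) -/a.
change (toB a = \sum_(w <- finmap.enum_fset (msupp a))
  a@_w *: \prod_(i <- (w : seq bool)) toB (letter k i)).
rewrite {1}(monalgE a) (big_morph toB toBD toB0); apply: eq_bigr => w _.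
rewrite -toB_word -toBZ; congr (toB _).
by apply/malgP => w'; rewrite mcoeffZ !mcoeffU mulrnAr mulr1.
Qed.

(* The generators are the classes of x and y, so deg x = deg y = 1. *)
Definition gradedB : fgAlg k := FgAlg algB_span.

End AlgB.

(* Main.v *)
From HB Require Import structures.
Require Import Defs.
From mathcomp Require Import all_boot finmap all_algebra zify boolp.
From mathcomp.classical Require Import classical_sets.
From mathcomp.multinomials Require Import monalg.
From Stdlib Require Import Relation_Operators.

Set Implicit Arguments.
Unset Strict Implicit.
Unset Printing Implicit Defensive.

Import GRing.Theory.
Local Open Scope ring_scope.
Local Open Scope quotient_scope.

(** Put [t_a = x y^a] for [0 <= a <= r]. As [y^(r+1) = 0], a word is zero in B or
    has the form [y^b t_a1 ... t_an] with [b <= r] (Lemma [word_normal]). Hence B is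
    free over the free algebra [A = k<t_0, ..., t_r>] with basis [1, y, ..., y^r],
    and an element of a B-module is torsion as soon as all long products of the
    [t_a] kill it. So up to torsion B behaves like A, which is hereditary, and the
    standard resolution of A-modules carries over.

    Let M be a graded B-module, I the set of its homogeneous elements, and s a
    graded k-linear section of the evaluation of k^(I) in M; it comes from
    Zorn's lemma ([graded_section]). Let P0 be the free B-module with generators [i]
    for i in I, and let P1 be free on the pairs (a, i). In QGr B the sequence

      0 -> P1 -> P0 -> M -> 0,   (a, i) |-> t_a[i] - s(t_a i),   [i] |-> i

    is exact. The first map is injective by comparison of leading terms
    ([delta_lead]). Modulo its image each [t_a] maps P0 into the combinations of
    generators, so [t_a u] is congruent to s of its image in M, and [t_a u] is in
    the image of P1 for all a if u is in the kernel of P0 -> M: the homology is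
    torsion ([eps_exact]).

    Free modules are projective in QGr B ([freemod_projective]): the products of n
    factors [t_a] with a generator are independent over B and generate a submodule
    with torsion quotient, so their images may be lifted one by one. Consequently
    every element of Ext^2(M, N) receives a morphism from the splice of the
    resolution with the split extension of P1 by N ([Ext2_zero]).

    For Ext^1 take M = k[x] = B/By. A section of P0 -> M would send some x^n to an
    element u with y x u torsion. But y x is injective on free modules, because
    r >= 1, and these are torsion-free; so u = 0, while x^n is not torsion
    ([line_nonsplit]). Thus the resolution of k[x] is an extension without section,
    and having a section depends only on the class in Ext^1 ([section_mor]).

    Morphisms of QGr B are relations; two of them are equal if and only if their
    values differ by torsion ([qeq_torselP]), and this reduces all diagrams to
    statements on elements. *)

(** * Torsion elements and equality of morphisms *)

Section Torsion.
Variables (k : fieldType) (B : fgAlg k).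
Implicit Types (L M N : grmod B).

(** For a graded submodule [Q] this says that [m] is torsion modulo [Q].
    Fdim consists of the modules all of whose elements are absorbed by 0. *)
Definition absorbed M (Q : M -> Prop) (m : M) :=
  exists n, forall w, size w = n -> Q (wact w m).

Definition torsel M (m : M) := absorbed (fun u => u = 0) m.

Lemma absorbed_trans M (Q R : M -> Prop) m : is_gsub R ->
  absorbed Q m -> (forall u, Q u -> absorbed R u) -> absorbed R m.
Proof.
move=> gR Qm QR; apply: (@tors_trans _ _ _ (eq m) Q R) => // _ <-; exact: Qm.
Qed.

Lemma absorbed_sub M (Q Q' : M -> Prop) m :
  (forall u, Q u -> Q' u) -> absorbed Q m -> absorbed Q' m.
Proof. by move=> QQ' [n Qn]; exists n => w /Qn/QQ'. Qed.

Lemma absorbedI M (Q Q' : M -> Prop) m : is_gsub Q -> is_gsub Q' ->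
  absorbed Q m -> absorbed Q' m -> absorbed (fun u => Q u /\ Q' u) m.
Proof.
by move=> gQ gQ' Qm Qm'; apply: (@torsI _ _ _ (eq m)) => // _ <-.
Qed.

Lemma scalkA M (c d : k) (m : M) : (c * d)%:A *: m = c%:A *: (d%:A *: m).
Proof. by rewrite scalerA mulr_algl scalerA. Qed.

Lemma scalkD M (m : M) : {morph (fun c : k => c%:A *: m) : c d / c + d}.
Proof. by move=> c d; rewrite !scalerDl. Qed.

Lemma scal1k M (m : M) : (1 : k)%:A *: m = m.
Proof. by rewrite !scale1r. Qed.

Lemma scalkCA M (c : k) (b : B) (m : M) : b *: (c%:A *: m) = c%:A *: (b *: m).
Proof. by rewrite !scalerA mulr_algl mulr_algr. Qed.

Lemma actZ M w (c : k) (m : M) : wact w (c%:A *: m) = c%:A *: wact w m.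
Proof.
by elim: w => //= b w ->; rewrite !scalerA mulr_algl mulr_algr.
Qed.

Lemma actN M w (m : M) : wact w (- m) = - wact w m.
Proof. by apply: (addrI (wact w m)); rewrite -actD !subrr act0. Qed.

Lemma actB M w (u v : M) : wact w (u - v) = wact w u - wact w v.
Proof. by rewrite actD actN. Qed.

Lemma absorbed_gsub M (Q : M -> Prop) : is_gsub Q -> is_gsub (absorbed Q).
Proof.
move=> gQ; have Q0 : absorbed Q 0.
  by exists 0%N => w _; rewrite act0; apply: gsub0.
have QD u v : absorbed Q u -> absorbed Q v -> absorbed Q (u + v).
  move=> [n Qu] [n' Qv]; exists (maxn n n') => w sw; rewrite actD.
  apply: gsubD => //; first exact: (tors_ge gQ (leq_maxl n n') Qu sw).
  exact: (tors_ge gQ (leq_maxr n n') Qv sw).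
split=> //; last first.
  move=> i u [n Qn]; exists n => w sw.
  rewrite -[i](addrNK (size w)%:Z) addrC -part_act; apply: gsub_part => //.
  exact: Qn.
apply: subspace_closedZ => // [c u|b u] [n Qn]; exists n => w sw.
  by rewrite actZ; apply: gsubZ => //; apply: Qn.
have -> : wact w (fg_gen b *: u) = wact (rcons w b) u by rewrite -cats1 act_cat.
apply: (@tors_ge _ _ _ Q u n n.+1) => //; by rewrite size_rcons sw.
Qed.

Lemma torsel_gsub M : is_gsub (@torsel M).
Proof. exact/absorbed_gsub/gsub_zero. Qed.

Lemma torsel0 M : torsel (0 : M).
Proof. exact: (gsub0 (torsel_gsub M)). Qed.

Lemma torselN M (m : M) : torsel m -> torsel (- m).
Proof. exact: (gsubN (torsel_gsub M)). Qed.

Lemma torselD M (u v : M) : torsel u -> torsel v -> torsel (u + v).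
Proof. exact: (gsubD (torsel_gsub M)). Qed.

Lemma torsel_absorbed M (m : M) : absorbed (@torsel M) m -> torsel m.
Proof. by move=> tm; apply: (@absorbed_trans M (@torsel M) _ m (gsub_zero M) tm). Qed.

Lemma absorbed_dom M N (f : qhom M N) m : absorbed (qdom f) m.
Proof. exact: tors_dom I. Qed.

Lemma gsub_domh M N (f : qhom M N) : is_gsub (qdom f).
Proof. exact/gsub_dom/graph_rel. Qed.

Lemma qhom0 M N (f : qhom M N) : f 0 0.
Proof. exact: (grel0 (graph_rel f)). Qed.

Lemma qhom_indet M N (f : qhom M N) n : f 0 n -> torsel n.
Proof. exact: tors_indet. Qed.

Lemma qhomB M N (f : qhom M N) m m' n n' : f m n -> f m' n' -> f (m - m') (n - n').
Proof. exact: (grelB (graph_rel f)). Qed.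

Lemma qhom_act M N (f : qhom M N) w m n : f m n -> f (wact w m) (wact w n).
Proof. exact: (grel_act (graph_rel f)). Qed.

Lemma qhom_torsel M N (f : qhom M N) m n : f m n -> torsel m -> torsel n.
Proof.
move=> fmn [l ml]; apply: torsel_absorbed; exists l => w /ml w0.
by apply: (@tors_indet _ _ _ _ f); rewrite /qindet -w0; apply: qhom_act.
Qed.

Lemma qhom_uniq M N (f : qhom M N) m m' n n' :
  f m n -> f m' n' -> torsel (m - m') -> torsel (n - n').
Proof. by move=> fm fm'; apply: (qhom_torsel (qhomB fm fm')). Qed.

Lemma qhom_det M N (f : qhom M N) m n n' : f m n -> f m n' -> torsel (n - n').
Proof. by move=> fm fm'; apply: (qhom_uniq fm fm'); rewrite subrr; apply: torsel0. Qed.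

(** No common domain and no common indeterminacy have to be named: the elements
    on which both relations are defined absorb everything, and the torsion
    elements of [N] are the largest indeterminacy that Fdim allows. *)
Lemma qeq_torselP M N (f g : qhom M N) :
  qeq f g <-> (forall m n n', f m n -> g m n' -> torsel (n - n')).
Proof.
split=> [/qeqP[P [Q [[gP gQ] [tP tQ] Pd Qi E]]] m n n' fn gn|E].
  have [l Pl] := tP m I; apply: torsel_absorbed; exists l => w /Pl Pw.
  by apply: tQ; rewrite actB; apply: E Pw _ _; apply: qhom_act.
apply/qeqP; exists (fun m => qdom f m /\ qdom g m), (@torsel N); split => //.
- split; last exact: torsel_gsub.
  have gf := gsub_domh f; have gg := gsub_domh g.
  split=> [|u v [? ?] [? ?]|b u [? ?]|i u [? ?]].
  + by split; apply: gsub0.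
  + by split; apply: gsubD.
  + by split; apply: gsubZ.
  + by split; apply: gsub_part.
- split=> //; apply: torsI; by [apply: gsub_domh|apply: tors_dom].
- by move=> n [|]; apply: tors_indet.
- by move=> m n n' _; apply: E.
Qed.

Lemma absorbed_along M N (f : qhom M N) (Q : N -> Prop) m n : f m n ->
  absorbed Q n -> absorbed (fun u => exists2 v, f u v & Q v) m.
Proof.
move=> fm [l Ql]; exists l => w /Ql Qw; exists (wact w n) => //.
exact: qhom_act.
Qed.

Lemma absorbed_along_conv M N (f : qhom M N) (Q : M -> Prop) m n : f m n ->
  absorbed Q m -> absorbed (fun v => exists2 u, f u v & Q u) n.
Proof.
move=> fm [l Ql]; exists l => w /Ql Qw; exists (wact w m) => //.
exact: qhom_act.
Qed.

Lemma conv_grel M N (G : M -> N -> Prop) : is_grel G -> is_grel (fun n m => G m n).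
Proof.
move=> gG; split=> [|m m' n n'|b m n|i m n]; first exact: grel0.
- exact: grelD.
- exact: grelZ.
- exact: grel_part.
Qed.

Lemma comp_grel L M N (G : L -> M -> Prop) (H : M -> N -> Prop) :
  is_grel G -> is_grel H -> is_grel (fun l n => exists2 m, G l m & H m n).
Proof.
move=> gG gH.
split=> [|l l' n n' [m Gm Hm] [m' Gm' Hm']|b l n [m Gm Hm]|i l n [m Gm Hm]].
- by exists 0; apply: grel0.
- by exists (m + m'); apply: grelD.
- by exists (b *: m); apply: grelZ.
- by exists (part i m); apply: grel_part.
Qed.

Lemma absorbed_grelP M N (G : M -> N -> Prop) : is_grel G ->
  (forall m, absorbed (qdom G) m) -> (forall n, G 0 n -> torsel n) ->
  exists f : qhom M N, graph f = G.
Proof.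
by move=> gG dG iG; exists (mk_qhom gG (fun m _ => dG m) iG).
Qed.

End Torsion.

(** * The additive structure of the quotient category *)

Lemma subrACA (V : zmodType) (a b c d : V) : (a - b) - (c - d) = (a - c) - (b - d).
Proof. by rewrite opprD addrACA -opprD. Qed.

Section Additive.
Variables (k : fieldType) (B : fgAlg k).
Implicit Types (L M N : grmod B).

Section Ops.
Variables M N : grmod B.
Implicit Types f g : qhom M N.

Definition qfun (phi : M -> N) (gphi : is_grel (fun m n => phi m = n)) : qhom M N.
Proof.
apply: (mk_qhom gphi) => [m _|n n0].
  by exists 0%N => w _; eexists.
rewrite -[n]n0; exists 0%N => w _.
by move: (grel0 gphi) => ->; rewrite act0.
Defined.

Lemma zero_rel : is_grel (fun (m : M) (n : N) => 0 = n).
Proof.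
split=> // [_ _ _ _ <- <-|b m _ <-|i m _ <-]; first by rewrite addr0.
  by rewrite scaler0.
by rewrite part0.
Qed.

Definition qzero : qhom M N := qfun zero_rel.

Lemma opp_rel f : is_grel (fun m n => f m (- n)).
Proof.
have gf := graph_rel f; split=> [|m m' n n' fm fm'|b m n fm|i m n fm].
- by rewrite oppr0; apply: grel0.
- by rewrite opprD; apply: grelD.
- by rewrite -scalerN; apply: grelZ.
- by rewrite -partN; apply: grel_part.
Qed.

Definition qopp f : qhom M N.
Proof.
apply: (mk_qhom (opp_rel f)) => [m _|n fn].
  have [l fl] := absorbed_dom f m; exists l => w /fl[n fn].
  by exists (- n); rewrite opprK.
by rewrite -[n]opprK; apply/torselN/(qhom_indet fn).
Defined.

Lemma add_rel f g : is_grel (fun m n => exists2 n1, f m n1 & g m (n - n1)).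
Proof.
have gf := graph_rel f; have gg := graph_rel g.
split=> [|m m' n n' [u fu gu] [u' fu' gu']|b m n [u fu gu]|i m n [u fu gu]].
- by exists 0; rewrite ?subr0; apply: grel0.
- exists (u + u'); first exact: grelD.
  by rewrite opprD addrACA; apply: grelD.
- by exists (b *: u); rewrite -?scalerBr; apply: grelZ.
- by exists (part i u); rewrite -?partN -?partD; apply: grel_part.
Qed.

Definition qadd f g : qhom M N.
Proof.
apply: (mk_qhom (add_rel f g)) => [m _|n [u fu gu]].
  have [l fl] := absorbedI (gsub_domh f) (gsub_domh g) (absorbed_dom f m)
    (absorbed_dom g m).
  exists l => w /fl[[n fn] [n' gn']]; exists (n + n'), n => //.
  by rewrite addrAC subrr add0r.
by rewrite -[n](subrK u); apply: torselD; [apply: qhom_indet gu|apply: qhom_indet fu].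
Defined.

End Ops.

Lemma qadd_heq M N (f f' g g' : qhom M N) :
  qeq f f' -> qeq g g' -> qeq (qadd f g) (qadd f' g').
Proof.
move=> /qeq_torselP E /qeq_torselP E'; apply/qeq_torselP.
move=> m n n' [u fu gu] [u' fu' gu'].
have -> : n - n' = (u - u') + ((n - u) - (n' - u')).
  by rewrite [n - u + _]subrACA [RHS]addrC subrK.
by apply: torselD; [apply: E fu fu'|apply: E' gu gu'].
Qed.

Lemma qopp_heq M N (f f' : qhom M N) : qeq f f' -> qeq (qopp f) (qopp f').
Proof.
move=> /qeq_torselP E; apply/qeq_torselP => m n n' fn fn'.
by rewrite -[_ - _]opprK opprD; apply/torselN/(E _ _ _ fn fn').
Qed.

Lemma qadd0 M N (f : qhom M N) : qeq (qadd f (qzero M N)) f.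
Proof.
apply/qeq_torselP => m n n' [u fu /= /esym/eqP]; rewrite subr_eq0 => /eqP->.
exact: qhom_det.
Qed.

Lemma qadd_zero_l M N (f : qhom M N) : qeq (qadd (qzero M N) f) f.
Proof. by apply/qeq_torselP => m n n' [_ <-]; rewrite subr0; apply: qhom_det. Qed.

Lemma qaddN M N (f : qhom M N) : qeq (qadd f (qopp f)) (qzero M N).
Proof.
apply/qeq_torselP => m n _ [u fu fn] <- /=; rewrite subr0.
by rewrite -[n](subrK u) -[n - u]opprK addrC; apply: qhom_det fu fn.
Qed.

(** Composites of relations are compared through [qeq_torselP], so that
    bilinearity reduces to the fact that morphisms preserve torsion. *)
Lemma qcomp_addl L M N (g g' : qhom M N) (f : qhom L M) :
  qeq (qcomp (qadd g g') f) (qadd (qcomp g f) (qcomp g' f)).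
Proof.
apply/qeq_torselP => l n n' [m fm [u gu gu']] [v [m1 fm1 gv] [m2 fm2 gv']].
have -> : n - n' = (u - v) + ((n - u) - (n' - v)).
  by rewrite [n - u + _]subrACA [RHS]addrC subrK.
apply: torselD; first by apply: qhom_uniq gu gv _; apply: qhom_det fm fm1.
by apply: qhom_uniq gu' gv' _; apply: qhom_det fm fm2.
Qed.

Lemma qcomp_addr L M N (g : qhom M N) (f f' : qhom L M) :
  qeq (qcomp g (qadd f f')) (qadd (qcomp g f) (qcomp g f')).
Proof.
apply/qeq_torselP => l n n' [m [u fu fu'] gm] [v [m1 fm1 gv] [m2 fm2 gv']].
have -> : n - n' = n - (v + (n' - v)) by rewrite [v + _]addrC subrK.
apply: (qhom_uniq gm (grelD (graph_rel g) gv gv')).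
have -> : m - (m1 + m2) = (u - m1) + ((m - u) - m2).
  by rewrite [RHS]addrACA -opprD [u + _]addrC subrK.
by apply: torselD; [apply: qhom_det fu fm1 | apply: qhom_det fu' fm2].
Qed.

Lemma qcomp_oppr L M N (g : qhom M N) (f : qhom L M) :
  qeq (qcomp g (qopp f)) (qopp (qcomp g f)).
Proof.
apply/qeq_torselP => l n n' [m fm gm] [m' fm' gm'].
have gn' : g (- m') n' by have := qhomB (qhom0 g) gm'; rewrite !sub0r opprK.
apply: (qhom_uniq gm gn'); rewrite opprK -[_ + _]opprK opprD.
by apply/torselN/(@qhom_det _ _ _ _ f _ _ _ fm fm').
Qed.

Lemma qcomp_oppl L M N (g : qhom M N) (f : qhom L M) :
  qeq (qcomp (qopp g) f) (qopp (qcomp g f)).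
Proof.
apply/qeq_torselP => l n n' [m fm gm] [m' fm' gm'].
rewrite -[_ - _]opprK opprD; apply/torselN.
by apply: (@qhom_uniq _ _ _ _ g m m') => //; apply: qhom_det fm fm'.
Qed.

Section Zero.

Definition zero_mod : grmod B.
Proof.
apply: (@GrMod k B 'rV[B]_0 (fun _ v => v)) => // [i j v|v].
  by case: eqP => // _; rewrite [v]thinmx0.
by exists [::] => //; rewrite [v]thinmx0 big_nil.
Defined.

Lemma zero_objP : zero_obj (zero_mod : QGr B).
Proof.
have Z (z : zero_mod) : z = 0 by rewrite [z]thinmx0.
move=> X; split.
  exists (qzero X zero_mod) => f; apply/qeq_torselP => m n n' _ _.
  by rewrite [_ - _]Z; apply: torsel0.
exists (qzero zero_mod X) => f; apply/qeq_torselP => m n n' /= <- fm.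
by rewrite sub0r; apply/torselN; apply: qhom_torsel fm _; rewrite [m]Z; apply: torsel0.
Qed.

(** The identity of a zero object is its zero map, which makes every element of
    it torsion; conversely a map with torsion values is equal to the zero map,
    which factors through the zero module. *)
Lemma zero_morP (M N : grmod B) (f : qhom M N) :
  @zero_mor (QGr B) M N f <-> (forall m n, f m n -> torsel n).
Proof.
split=> [[Z [g [h [Z0 E]]]] m n fmn|f0]; last first.
  exists zero_mod, (qzero _ _ : qhom zero_mod N), (qzero _ _ : qhom M zero_mod).
  split; first exact: zero_objP.
  apply/qeq_torselP => m n _ /f0 tn [_ _ <-]; rewrite subr0; exact: tn.
have tZ (z : (Z : grmod B)) : torsel z.
  have [_ [e He]] := Z0 Z; have E0 := qeq_trans (qeq_sym (He (qid Z))) (He (qzero Z Z)).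
  by have /qeq_torselP/(_ z z 0 erefl erefl) := E0; rewrite subr0.
have gh0 : qeq (qcomp g h) (qzero M N).
  apply/qeq_torselP => l p _ [z _ gz] <-; rewrite subr0; exact: qhom_torsel gz (tZ z).
have /qeq_torselP/(_ m n 0 fmn erefl) := qeq_trans E gh0.
by rewrite subr0.
Qed.

Lemma zero_morE (M N : grmod B) (f : qhom M N) : @zero_mor (QGr B) M N f <-> qeq f (qzero M N).
Proof.
split=> [/zero_morP f0|E]; first by apply/qeq_torselP => m n _ /f0 tn <-; rewrite subr0.
by apply/zero_morP => m n fn; have /qeq_torselP/(_ m n 0 fn erefl) := E; rewrite subr0.
Qed.

End Zero.

(** Exactness is only needed up to torsion. The factorizations that a kernel and
    a cokernel ask for are the relations [f^-1 t] and [t g^-1]; the hypotheses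
    say precisely that their domains are large and their indeterminacies small. *)
Section Exact.
Variables (X Y Z : grmod B) (f : qhom X Y) (g : qhom Y Z).
Hypothesis f_mono : forall x y, f x y -> torsel y -> torsel x.
Hypothesis gf0 : forall x y z, f x y -> g y z -> torsel z.
Hypothesis gf_exact :
  forall y z, g y z -> torsel z -> absorbed (fun u => exists x, f x u) y.
Hypothesis g_epi : forall z, absorbed (fun u => exists y, g y u) z.

Lemma range_gsub M N (h : qhom M N) : is_gsub (fun n => exists m, h m n).
Proof.
have gh := graph_rel h; split=> [|u v [m hm] [m' hm']|b u [m hm]|i u [m hm]].
- by exists 0; apply: grel0.
- by exists (m + m'); apply: grelD.
- by exists (b *: m); apply: grelZ.
- by exists (part i m); apply: grel_part.
Qed.

Lemma exact_kernel : is_kernel (C := QGr B) f g.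
Proof.
split; first by apply/zero_morP => x z [y fy gy]; apply: gf0 fy gy.
move=> T t /zero_morP gt0.
have rG := comp_grel (graph_rel t) (conv_grel (graph_rel f)).
have [a|x [y ty fy]|u uE] := absorbed_grelP rG.
- have gd := gsub_dom rG.
  apply: (absorbed_trans gd (absorbed_dom t a)) => {}a [y ty].
  apply: (absorbed_trans gd (absorbed_along ty (absorbed_dom g y))).
  move=> {ty}a [{}y ty [z gy]].
  have tz : torsel z by apply: (gt0 a); exists y.
  apply: (absorbed_sub _ (absorbed_along ty (gf_exact gy tz))).
  by move=> b [y' ty' [x fx]]; exists x, y'.
- by apply: f_mono fy _; apply: qhom_indet ty.
exists u; split.
  apply/qeq_torselP => a y1 y2 [x]; rewrite uE => -[y ty fy] fy1 ty2.
  rewrite -[y1](subrK y) -addrA; apply: torselD; first exact: qhom_det fy1 fy.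
  exact: qhom_det ty ty2.
move=> u' /qeq_torselP E; apply/qeq_torselP => a x x'.
rewrite uE => -[y ty fy] ux'.
have [l fl] := absorbed_dom f (x - x').
apply: torsel_absorbed; exists l => w /fl[y' fy'].
apply: (f_mono fy').
have fx' : f (wact w x') (wact w y - y').
  have := qhomB (qhom_act w fy) fy'.
  by rewrite actB opprB addrC subrK.
have := E _ _ _ (ex_intro2 _ _ _ (qhom_act w ux') fx') (qhom_act w ty).
by rewrite addrAC subrr add0r => /torselN; rewrite opprK.
Qed.

Lemma exact_cokernel : is_cokernel (C := QGr B) g f.
Proof.
split; first by apply/zero_morP => x z [y fy gy]; apply: gf0 fy gy.
move=> T t /zero_morP tf0.
have rG := comp_grel (conv_grel (graph_rel g)) (graph_rel t).
have [z|a [y gy ty]|u uE] := absorbed_grelP rG.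
- have gd := gsub_dom rG.
  apply: (absorbed_trans gd (g_epi z)) => {}z [y gy].
  apply: (absorbed_sub _ (absorbed_along_conv gy (absorbed_dom t y))).
  by move=> z' [y' gy' [a ta]]; exists a, y'.
- have [l fl] := gf_exact gy (torsel0 Z).
  apply: torsel_absorbed; exists l => w /fl[x fx].
  by apply: (tf0 x); exists (wact w y) => //; apply: qhom_act.
exists u; split.
  apply/qeq_torselP => y a a' [z gz]; rewrite uE => -[y' gz' ty'] ty.
  have gy : g (y' - y) 0 by rewrite -(subrr z); apply: qhomB.
  have ta := qhomB ty' ty.
  have [l fl] := gf_exact gy (torsel0 Z).
  apply: torsel_absorbed; exists l => w /fl[x fx].
  by apply: (tf0 x); exists (wact w (y' - y)) => //; apply: qhom_act.
move=> u' /qeq_torselP E; apply/qeq_torselP => z a a'.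
rewrite uE => -[y gy ty] ua'.
rewrite -opprB; apply/torselN/(E y) => //; by exists z.
Qed.

End Exact.
End Additive.

(** * Quotient modules, direct sums and surjectivity of cokernels *)

Section QuotientModule.
Variables (k : fieldType) (B : fgAlg k) (M : grmod B) (P : M -> Prop).
Hypothesis gP : is_gsub P.

Definition gsub_pred : {pred M} := fun m => `[< P m >].

Lemma gsub_pred_zmod : zmod_closed gsub_pred.
Proof.
split=> [|u v /asboolP Pu /asboolP Pv]; apply/asboolP; first exact: gsub0.
exact: gsubB.
Qed.

HB.instance Definition _ := GRing.isZmodClosed.Build M gsub_pred gsub_pred_zmod.

Definition gquot := Quotient.quot gsub_pred.

HB.instance Definition _ := GRing.Zmodule.on gquot.

Definition gproj : M -> gquot := \pi.

Lemma gproj_eq u v : gproj u = gproj v <-> P (u - v).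
Proof.
rewrite /gproj; split=> [/eqP|Puv]; last apply/eqP.
  by rewrite -Quotient.idealrBE => /asboolP.
by rewrite -Quotient.idealrBE; apply/asboolP.
Qed.

Lemma gproj_repr q : gproj (repr q) = q. Proof. exact: reprK. Qed.

Lemma gprojD u v : gproj (u + v) = gproj u + gproj v.
Proof. by rewrite /gproj !piE. Qed.

Lemma gproj0 : gproj 0 = 0.
Proof. by rewrite /gproj !piE. Qed.

Lemma repr_gproj u : P (repr (gproj u) - u).
Proof. by apply/gproj_eq; rewrite gproj_repr. Qed.

Definition gquot_scale (b : B) (q : gquot) := gproj (b *: repr q).

Lemma gprojZ b u : gproj (b *: u) = gquot_scale b (gproj u).
Proof.
by apply/esym/gproj_eq; rewrite -scalerBr; apply: gsubZ => //; apply: repr_gproj.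
Qed.

Lemma gquot_scaleA b c q : gquot_scale b (gquot_scale c q) = gquot_scale (b * c) q.
Proof. by rewrite -[q]gproj_repr -!gprojZ scalerA. Qed.

Lemma gquot_scale1 : left_id 1 gquot_scale.
Proof. by move=> q; rewrite -[q]gproj_repr -!gprojZ scale1r. Qed.

Lemma gquot_scaleDr : right_distributive gquot_scale +%R.
Proof.
move=> b q q'; rewrite -[q]gproj_repr -[q']gproj_repr.
by rewrite -gprojD -!gprojZ -gprojD scalerDr.
Qed.

Lemma gquot_scaleDl q : {morph gquot_scale^~ q : b c / b + c}.
Proof. by move=> b c; rewrite -[q]gproj_repr -!gprojZ -gprojD scalerDl. Qed.

HB.instance Definition _ := GRing.Zmodule_isLmodule.Build B gquot
  gquot_scaleA gquot_scale1 gquot_scaleDr gquot_scaleDl.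

Definition gquot_part i (q : gquot) := gproj (part i (repr q)).

Lemma gproj_part i u : gproj (part i u) = gquot_part i (gproj u).
Proof.
by apply/esym/gproj_eq; rewrite -partN -partD; apply/(gsub_part gP)/repr_gproj.
Qed.

Definition quot_mod : grmod B.
Proof.
apply: (@GrMod k B gquot gquot_part) => [i q q'|i j q|q|d b i q bd].
- by rewrite -[q]gproj_repr -[q']gproj_repr -gprojD -!gproj_part partD gprojD.
- rewrite -[q]gproj_repr -!gproj_part part_part; case: eqP => // _; exact: gproj0.
- have [s us E] := part_sum (repr q); exists s => //.
  rewrite -{1}[q]gproj_repr E (big_morph gproj gprojD gproj0).
  by apply: eq_bigr => i _; rewrite gproj_part gproj_repr.
rewrite -[q]gproj_repr.
change (gquot_part (d + i) (gquot_scale b (gproj (repr q))) =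
  gquot_scale b (gquot_part i (gproj (repr q)))).
by rewrite -gprojZ -!gproj_part -gprojZ partZ.
Defined.

Lemma gproj_rel : is_grel (fun (m : M) (q : quot_mod) => gproj m = q).
Proof.
split=> [|m m' _ _ <- <-|b m _ <-|i m _ <-]; first exact: gproj0.
- exact: gprojD.
- exact: gprojZ.
- exact: gproj_part.
Qed.

Lemma gproj_torsel m : torsel (gproj m : quot_mod) -> absorbed P m.
Proof.
move=> [n q0]; exists n => w /q0 E; rewrite -[wact w m]subr0; apply/gproj_eq.
by rewrite gproj0 -E; exact: (grel_act gproj_rel w (erefl (gproj m))).
Qed.

End QuotientModule.

Section SplitSes.
Variables (k : fieldType) (B : fgAlg k).

(** Degrees outside [s] contribute nothing, so that the two components of a pair
    can be decomposed over the same degrees. *)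
Lemma part_sum_sup (M : grmod B) (v : M) (s s' : seq int) : uniq s -> uniq s' ->
  {subset s <= s'} -> v = \sum_(i <- s) part i v -> v = \sum_(i <- s') part i v.
Proof.
move=> us us' ss' vE; rewrite (bigID (mem s)) /= [X in _ + X]big1 ?addr0 => [|i nis].
  rewrite -big_filter {1}vE; apply: perm_big; apply: uniq_perm => // [|i].
    exact: filter_uniq.
  by rewrite mem_filter andb_idr //; apply: ss'.
rewrite vE part_bigsum big1_seq // => j /andP[_ js].
by rewrite part_part; case: eqP => // ij; rewrite ij js in nis.
Qed.

Definition prod_mod (M N : grmod B) : grmod B.
Proof.
apply: (@GrMod k B (M * N)%type (fun i v => (part i v.1, part i v.2))).
- by move=> i u v; rewrite /= !partD.
- move=> i j v /=; rewrite !part_part; by case: eqP.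
- move=> v; have [s us E] := part_sum v.1; have [t ut E'] := part_sum v.2.
  have uu : uniq (undup (s ++ t)) by exact: undup_uniq.
  exists (undup (s ++ t)) => //.
  have -> r : \sum_(i <- r) ((part i v.1, part i v.2) : M * N) =
      (\sum_(i <- r) part i v.1, \sum_(i <- r) part i v.2).
    by elim: r => [|i r IH]; rewrite ?big_nil // !big_cons IH.
  rewrite -(part_sum_sup us uu _ E); last first.
    by move=> i; rewrite mem_undup mem_cat => ->.
  rewrite -(part_sum_sup ut uu _ E'); first exact: surjective_pairing.
  by move=> i; rewrite mem_undup mem_cat orbC => ->.
- by move=> d b i v bd; rewrite /= !partZ.
Defined.

Variables M N : grmod B.
Let P := prod_mod M N.

Lemma inl_rel : is_grel (fun (m : M) (p : P) => (m, 0) = p).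
Proof.
split=> // [m m' _ _ <- <-|b m _ <-|i m _ <-]; congr pair.
- exact/esym/addr0.
- exact/esym/scaler0.
- exact/esym/part0.
Qed.

Lemma inr_rel : is_grel (fun (n : N) (p : P) => (0, n) = p).
Proof.
split=> // [n n' _ _ <- <-|b n _ <-|i n _ <-]; congr pair.
- exact/esym/addr0.
- exact/esym/scaler0.
- exact/esym/part0.
Qed.

Lemma fst_rel : is_grel (fun (p : P) (m : M) => p.1 = m).
Proof. by split=> // [p p' _ _ <- <-|b p _ <-|i p _ <-]. Qed.

Lemma snd_rel : is_grel (fun (p : P) (n : N) => p.2 = n).
Proof. by split=> // [p p' _ _ <- <-|b p _ <-|i p _ <-]. Qed.

Definition qinl : qhom M P := qfun inl_rel.
Definition qinr : qhom N P := qfun inr_rel.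
Definition qfst : qhom P M := qfun fst_rel.
Definition qsnd : qhom P N := qfun snd_rel.

Lemma fst_act w (p : P) : (wact w p).1 = wact w p.1.
Proof. by elim: w => //= b w <-. Qed.

Lemma snd_act w (p : P) : (wact w p).2 = wact w p.2.
Proof. by elim: w => //= b w <-. Qed.

Lemma split_exact : is_kernel (C := QGr B) qinl qsnd /\
  is_cokernel (C := QGr B) qsnd qinl.
Proof.
have e1 x y : qinl x y -> torsel y -> torsel x.
  by move=> <- [n y0]; exists n => w /y0/(congr1 fst); rewrite fst_act.
have e2 x y z : qinl x y -> qsnd y z -> torsel z.
  by move=> <- <-; apply: torsel0.
have e3 y z : qsnd y z -> torsel z -> absorbed (fun u => exists x, qinl x u) y.
  move=> <- [n z0]; exists n => w /z0 E; exists (wact w y).1.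
  by rewrite /= [RHS]surjective_pairing; congr pair; rewrite snd_act E.
have e4 z : absorbed (fun u => exists y, qsnd y u) z.
  by exists 0%N => w _; exists (0, wact w z).
by split; [apply: exact_kernel | apply: exact_cokernel].
Qed.

Definition split_ses : ses (M : QGr B) N :=
  Ses (proj1 split_exact) (proj2 split_exact).

End SplitSes.

Section Epi.
Variables (k : fieldType) (B : fgAlg k).

(** The projection of [Z] onto its quotient by the range of [p] and the zero map
    agree after [p], hence they are equal; so the quotient is torsion. *)
Lemma cokernel_epi (X Y Z : grmod B) (p : qhom Y Z) (f : qhom X Y) :
  is_cokernel (C := QGr B) p f -> forall z, absorbed (fun z => exists y, p y z) z.
Proof.
move=> [_ puniv] z; set R := fun z => exists y, p y z.
have gR : is_gsub R by exact: range_gsub.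
pose q : qhom Z (quot_mod gR) := qfun (gproj_rel gR).
have t0 : @zero_mor (QGr B) _ _ (qcomp (qzero Y (quot_mod gR)) f).
  by apply/zero_morP => x n [y _ <-]; apply: torsel0.
have [u [_ uniq_u]] := puniv _ _ t0.
have uq := uniq_u q; have u0 := uniq_u (qzero _ _).
have /qeq_torselP q0 : qeq q (qzero Z (quot_mod gR)).
  apply: qeq_trans (qeq_sym (uq _)) (u0 _); apply/qeq_torselP.
    move=> y _ _ [z' py <-] <-; rewrite subr0.
    suff -> : gproj gR z' = gproj gR 0 by rewrite gproj0; apply: torsel0.
    by apply/gproj_eq; rewrite subr0; exists y.
  by move=> y _ _ [z' py <-] <-; rewrite subrr; apply: torsel0.
apply: (@gproj_torsel _ _ _ _ gR).
by have := q0 z _ _ erefl erefl; rewrite subr0.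
Qed.
End Epi.

(** * Ext groups from projective resolutions *)

Section Homology.
Variables (k : fieldType) (B : fgAlg k).
Notation C := (QGr B).

(** Epimorphisms enter in the concrete form that [cokernel_epi] provides. *)
Definition qprojective (P : grmod B) := forall (Y Z : grmod B) (p : qhom Y Z),
  (forall z, absorbed (fun z' => exists y, p y z') z) ->
  forall f : qhom P Z, exists g : qhom P Y, qeq (qcomp p g) f.

Lemma ses_comp0 (X Y : C) (s : ses X Y) :
  zero_mor (compo (ses_prj s) (ses_inj s)).
Proof. exact: proj1 (ses_kernel s). Qed.

Lemma ses_prj_epi (X Y : C) (s : ses X Y) (y : (Y : grmod B)) :
  absorbed (fun z => exists e, (ses_prj s : qhom (ses_mid s) Y) e z) y.
Proof. exact: (cokernel_epi (ses_cokernel s)). Qed.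

(** Projectivity of the middle term of [s0] lifts the identity of [M] to a
    morphism from [s0] to the second half of [x]; its restriction to [P1] lifts
    through the first half of [x] because [P1] is projective. Together with the
    inclusion of [N] this gives a morphism out of the split extension. *)
Lemma Ext2_resolution_mor (M N P1 : C) (s0 : ses P1 M) :
  qprojective P1 -> qprojective (ses_mid s0) -> forall x : Ext 2 M N,
  yext_mor (n := 1) (existT _ P1 (split_ses N P1, s0)) x (idm M).
Proof.
move=> pP1 pP0 [K [s t]] /=.
have [g0 Eg0] := pP0 _ _ _ (ses_prj_epi t) (ses_prj s0).
have [|c [Ec _]] := proj2 (ses_kernel t) P1 (qcomp g0 (ses_inj s0)).
  apply/zero_morE; apply: (qeq_trans (qcompA _ _ _)).
  apply: qeq_trans (qcomp_qeq Eg0 (qeq_refl _)) _.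
  by apply/zero_morE/ses_comp0.
exists c; split; last first.
  by exists g0; split; [apply: qeq_sym|apply: (qeq_trans Eg0); apply/qeq_sym/qcomp1m].
have [l El] := pP1 _ _ _ (ses_prj_epi s) c.
exists (qadd (qcomp (ses_inj s) (@qfst _ _ N P1)) (qcomp l (@qsnd _ _ N P1))); split.
  apply/qeq_torselP => n v v' [_ <- [v1 [_ <- i1] [_ <- l0]]] [_ <- i2].
  rewrite -[v](subrK v1) -addrA; apply: torselD; first exact: qhom_indet l0.
  exact: qhom_det i1 i2.
apply: (qeq_trans (qcomp_addr _ _ _)).
apply: qeq_trans (qadd_zero_l _); apply: qadd_heq.
  apply/zero_morE/zero_morP => p z [v [_ <- iv] jv].
  have /zero_morP h := ses_comp0 s; by apply: (h p.1); exists v.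
apply: (qeq_trans (qcompA _ _ _)); exact: qcomp_qeq El (qeq_refl _).
Qed.

(** All extensions receive a morphism from one and the same extension. *)
Theorem Ext2_zero :
  (forall M : C, exists (P1 : C) (s : ses P1 M),
     qprojective P1 /\ qprojective (ses_mid s)) ->
  Ext_identically_zero C 2.
Proof.
move=> res M N x x'; have [P1 [s [pP1 pP0]]] := res M.
have to y := Ext2_resolution_mor pP1 pP0 y.
apply: (rst_trans (yext 1 M N) (fun a b => yext_mor a b (idm M))).
  apply: (rst_sym (yext 1 M N)); apply: (rst_step (yext 1 M N)); exact: to.
by apply: (rst_step (yext 1 M N)); exact: to.
Qed.

Section Split.
Variables (N M : C).
Implicit Types s : ses N M.

Definition has_section s :=
  exists u : @Defs.hom C M (ses_mid s), heq (compo (ses_prj s) u) (idm M).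
Definition has_retraction s :=
  exists v : @Defs.hom C (ses_mid s) N, heq (compo v (ses_inj s)) (idm N).

(** The map [1 - u p] is killed by [p], so it factors through the kernel [i]. *)
Lemma section_retraction s : has_section s -> has_retraction s.
Proof.
move=> [u Eu]; case: s u Eu => E i p kerp cokp /= u Eu.
pose t := qadd (qid E) (qopp (qcomp u p)).
have pi0 : @zero_mor C _ _ (qcomp p i) := proj1 kerp.
have [|v [Ev _]] := proj2 kerp E t.
  apply/zero_morE; apply: (qeq_trans (qcomp_addr _ _ _)).
  apply: qeq_trans (qaddN p); apply: qadd_heq; first exact: qcompm1.
  apply: (qeq_trans (qcomp_oppr _ _)); apply: qopp_heq.
  apply: (qeq_trans (qcompA _ _ _)).
  exact: qeq_trans (qcomp_qeq Eu (qeq_refl _)) (qcomp1m _).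
have [w [_ uniq_w]] := proj2 kerp N i pi0.
exists v; apply: (qeq_trans (qeq_sym (uniq_w (qcomp v i) _))); last first.
  by apply: uniq_w; apply: qcompm1.
apply: (qeq_trans (qcompA _ _ _)).
apply: (qeq_trans (qcomp_qeq Ev (qeq_refl _))).
apply: (qeq_trans (qcomp_addl _ _ _)).
apply: qeq_trans (qadd0 i); apply: qadd_heq; first exact: qcomp1m.
apply/zero_morE/zero_morP => n e [e1 i1 [m p1 um]].
have /zero_morP h := pi0.
rewrite -[e]opprK; apply: torselN; apply: qhom_torsel um _.
by apply: (h n); exists e1.
Qed.

(** The map [1 - i v] kills [i], so it factors through the cokernel [p]. *)
Lemma retraction_section s : has_retraction s -> has_section s.
Proof.
move=> [v Ev]; case: s v Ev => E i p kerp cokp /= v Ev.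
pose t := qadd (qid E) (qopp (qcomp i v)).
have pi0 : @zero_mor C _ _ (qcomp p i) := proj1 kerp.
have [|u [Eu _]] := proj2 cokp E t.
  apply/zero_morE; apply: (qeq_trans (qcomp_addl _ _ _)).
  apply: qeq_trans (qaddN i); apply: qadd_heq; first exact: qcomp1m.
  apply: (qeq_trans (qcomp_oppl _ _)); apply: qopp_heq.
  apply: (qeq_trans (qeq_sym (qcompA _ _ _))).
  exact: qeq_trans (qcomp_qeq (qeq_refl _) Ev) (qcompm1 _).
have [w [_ uniq_w]] := proj2 cokp M p pi0.
exists u; apply: (qeq_trans (qeq_sym (uniq_w (qcomp p u) _))); last first.
  by apply: uniq_w; apply: qcomp1m.
apply: (qeq_trans (qeq_sym (qcompA _ _ _))).
apply: (qeq_trans (qcomp_qeq (qeq_refl _) Eu)).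
apply: (qeq_trans (qcomp_addr _ _ _)).
apply: qeq_trans (qadd0 p); apply: qadd_heq; first exact: qcompm1.
apply/zero_morE/zero_morP => e m [e1 [n vn i1] pm].
have /zero_morP h := pi0.
rewrite -[m]opprK; apply: torselN; apply: (h n).
exists (- e1) => //; by have := qhomB (qhom0 p) pm; rewrite !sub0r.
Qed.

(** A section is transported forwards along [e] and a retraction backwards; as
    each of the two yields the other, [e] does not have to be inverted. *)
Lemma section_mor s s' :
  ses_mor s s' (idm N) (idm M) -> has_section s <-> has_section s'.
Proof.
move=> [e [Ei Ep]]; split=> [[u Eu]|/section_retraction[v Ev]].
  exists (qcomp e u); apply: (qeq_trans (qcompA _ _ _)).
  apply: (qeq_trans (qcomp_qeq Ep (qeq_refl _))).
  apply: (qeq_trans (qeq_sym (qcompA _ _ _))).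
  exact: (qeq_trans (qcomp1m _)).
apply: retraction_section; exists (qcomp v e).
apply: (qeq_trans (qeq_sym (qcompA _ _ _))).
apply: (qeq_trans (qcomp_qeq (qeq_refl _) Ei)).
apply: (qeq_trans (qcompA _ _ _)).
exact: (qeq_trans (qcompm1 _)).
Qed.

End Split.

Lemma split_section (N M : C) : has_section (split_ses N M).
Proof.
exists (@qinr _ _ N M); apply/qeq_torselP => m _ _ [_ <- <-] <- /=.
by rewrite subrr; apply: torsel0.
Qed.

(** Having a section is constant on the classes of Ext^1 by [section_mor], and
    the split extension has one. *)
Theorem Ext1_nonzero (N M : C) (s : ses N M) :
  ~ has_section s -> ~ Ext_identically_zero C 1.
Proof.
move=> ns E; have : Ext_eq (n := 1) (split_ses N M) s := E M N _ _.
suff eqs (x y : ses N M) : Ext_eq (n := 1) x y -> has_section x <-> has_section y.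
  by move/eqs => [/(_ (split_section N M))].
elim=> {x y} [x y|x|x y _ [? ?]|x y z _ [? ?] _ [? ?]]; [exact: section_mor|by []|by []|by split; auto].
Qed.

End Homology.

(** * Modules with a monomial basis *)

(** The functions [phi x] are only additive in the coefficient: this covers
    linear extensions for every scalar action, the projections onto degrees and
    the action of a polynomial. *)
HB.lock Definition lext (k : fieldType) (K : choiceType) (V : zmodType)
    (phi : K -> k -> V) (u : {malg k[K]}) : V :=
  \sum_(x <- msupp u) phi x u@_x.

Section LinearExtension.
Variables (k : fieldType) (K : choiceType).
Implicit Types (u v : {malg k[K]}) (x : K).

Lemma malgZU (c d : k) x : c *: << d *g x >> = << c * d *g x >> :> {malg k[K]}.
Proof. by apply/malgP => y; rewrite mcoeffZ !mcoeffU mulrnAr. Qed.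

Lemma malg_supp_ind (S : K -> Prop) (Q : {malg k[K]} -> Prop) :
  Q 0 -> (forall u v, Q u -> Q v -> Q (u + v)) ->
  (forall c x, S x -> Q << c *g x >>) ->
  forall u, (forall x, x \in msupp u -> S x) -> Q u.
Proof.
move=> Q0 QD QU u Su; rewrite [u]monalgE big_seq.
by elim/big_ind: _ => // x xu; apply/QU/Su.
Qed.

Lemma malg_ind (Q : {malg k[K]} -> Prop) :
  Q 0 -> (forall u v, Q u -> Q v -> Q (u + v)) ->
  (forall c x, Q << c *g x >>) -> forall u, Q u.
Proof. by move=> Q0 QD QU u; apply: (@malg_supp_ind (fun=> True)). Qed.

Lemma malg_additive_eq (V : zmodType) (f g : {malg k[K]} -> V) :
  {morph f : u v / u + v} -> {morph g : u v / u + v} ->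
  (forall c x, f << c *g x >> = g << c *g x >>) -> f =1 g.
Proof.
move=> fD gD fg; have zero (h : {malg k[K]} -> V) : {morph h : u v / u + v} -> h 0 = 0.
  by move=> hD; apply: (addrI (h 0)); rewrite -hD !addr0.
by elim/malg_ind => [|u v|//]; rewrite ?zero // fD gD => -> ->.
Qed.

Variables (V : zmodType).
Implicit Types (phi : K -> k -> V).

Definition additive_family phi := forall x, {morph phi x : c d / c + d}.

Section Lext.
Variable phi : K -> k -> V.
Hypothesis phiD : additive_family phi.

Lemma additive_family0 x : phi x 0 = 0.
Proof. by apply: (addrI (phi x 0)); rewrite -phiD !addr0. Qed.

Lemma lextEw u (X : {fset K}) : (msupp u `<=` X)%fset ->
  lext phi u = \sum_(x <- X) phi x u@_x.
Proof.
move=> uX; rewrite unlock; apply: big_fset_incl => // x _ xu.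
by rewrite (mcoeff_outdom xu) additive_family0.
Qed.

Lemma lextD : {morph lext phi : u v / u + v}.
Proof.
move=> u v; rewrite (lextEw (msuppD_le u v)).
rewrite (lextEw (fsubsetUl (msupp u) (msupp v))).
rewrite (lextEw (fsubsetUr (msupp u) (msupp v))) -big_split /=.
by apply: eq_bigr => x _; rewrite mcoeffD phiD.
Qed.

Lemma lext0 : lext phi 0 = 0.
Proof. by rewrite unlock msupp0 big_seq_fset0. Qed.

Lemma lextN : {morph lext phi : u / - u}.
Proof. by move=> u; apply: (addrI (lext phi u)); rewrite -lextD !subrr lext0. Qed.

Lemma lextU c x : lext phi << c *g x >> = phi x c.
Proof. by rewrite (lextEw msuppU_le) big_seq_fset1 mcoeffUU. Qed.

End Lext.
End LinearExtension.

Section DegreeParts.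
Variables (k : fieldType) (K : choiceType) (deg : K -> int).
Implicit Types (u v : {malg k[K]}) (x : K) (c : k).

Definition malg_part i := lext (fun x (c : k) => if deg x == i then << c *g x >> else 0).

Lemma malg_part_add i :
  additive_family (fun x (c : k) => if deg x == i then << c *g x >> else 0).
Proof. by move=> x c d; case: eqP => _; rewrite ?monalgUD ?addr0. Qed.

Lemma malg_partD i : {morph malg_part i : u v / u + v}.
Proof. exact: (lextD (@malg_part_add i)). Qed.

Lemma malg_part0 i : malg_part i 0 = 0. Proof. exact: lext0. Qed.

Lemma malg_partU i c x :
  malg_part i << c *g x >> = if deg x == i then << c *g x >> else 0.
Proof. exact: (lextU (@malg_part_add i)). Qed.

Lemma malg_part_coef i u x : (malg_part i u)@_x = if deg x == i then u@_x else 0.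
Proof.
elim/malg_ind: u => [|u v IHu IHv|c y].
- by rewrite malg_part0 !mcoeff0 if_same.
- by rewrite malg_partD !mcoeffD IHu IHv; case: eqP => //; rewrite addr0.
rewrite malg_partU; have [dy|dy] := eqVneq (deg y) i; rewrite ?mcoeff0 !mcoeffU.
  by have [<-|_] := eqVneq y x; rewrite ?dy ?eqxx //= if_same.
by have [<-|_] := eqVneq y x; rewrite ?(negPf dy) // mulr0n if_same.
Qed.

Lemma malg_part_part i j u :
  malg_part i (malg_part j u) = if i == j then malg_part i u else 0.
Proof.
apply/malgP => x; rewrite !malg_part_coef.
have [->|ij] := eqVneq i j; rewrite ?malg_part_coef ?mcoeff0; first by case: eqP.
by case: eqP => // ->; rewrite (negPf ij).
Qed.

Lemma malg_part_sum u : exists2 s : seq int, uniq s & u = \sum_(i <- s) malg_part i u.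
Proof.
exists (undup [seq deg x | x <- finmap.enum_fset (msupp u)]); first exact: undup_uniq.
apply/malgP => x; rewrite (big_morph (fun v => v@_x) (mcoeffD x) (mcoeff0 _)).
under eq_bigr do rewrite malg_part_coef.
have [xu|xu] := boolP (x \in msupp u); last first.
  by rewrite (mcoeff_outdom xu) big1 // => i _; rewrite if_same.
rewrite (bigD1_seq (deg x)) ?undup_uniq //=; last first.
  by rewrite mem_undup; apply: map_f.
by rewrite eqxx big1 ?addr0 // => i; rewrite eq_sym => /negPf->.
Qed.

End DegreeParts.

(** A graded basis on which each letter (false for x, true for y) acts by partial
    maps, [None] being the zero vector, in such a way that [y^(r+1)] is zero. *)
Record monact (r : nat) := MonAct {
  mon_index :> choiceType;
  mon_deg : mon_index -> int;
  mon_step : bool -> mon_index -> option mon_index;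
  mon_deg_step : forall b x y, mon_step b x = Some y -> mon_deg y = 1 + mon_deg x;
  mon_nilp : forall x, iter r.+1 (obind (mon_step true)) (Some x) = None
}.

Section MonomialModule.
Variables (k : fieldType) (r : nat) (K : monact r).
Implicit Types (c d : k) (x y : K) (w : seq bool) (u v : {malg k[K]}).

Definition omon (o : option K) c : {malg k[K]} := if o is Some y then << c *g y >> else 0.

Lemma omonD o : {morph omon o : c d / c + d}.
Proof. by case: o => [x|] c d /=; rewrite ?monalgUD ?addr0. Qed.

Lemma omonZ o c d : c *: omon o d = omon o (c * d).
Proof.
by case: o => [x|] /=; [apply: malgZU | apply: scaler0].
Qed.

Definition mstep b := lext (fun x => omon (mon_step b x)).

Lemma mstep_add b : additive_family (fun x => omon (mon_step b x)).
Proof. by move=> x; apply: omonD. Qed.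

Lemma mstepD b : {morph mstep b : u v / u + v}.
Proof. exact: (lextD (@mstep_add b)). Qed.

Lemma mstepU b c x : mstep b << c *g x >> = omon (mon_step b x) c.
Proof. exact: (lextU (@mstep_add b)). Qed.

Lemma mstep_omon b o c : mstep b (omon o c) = omon (obind (mon_step b) o) c.
Proof. by case: o => [x|]; [apply: mstepU | apply: lext0]. Qed.

Lemma mstepZ b c u : mstep b (c *: u) = c *: mstep b u.
Proof.
elim/malg_ind: u => [|u v IHu IHv|d x].
- by rewrite scaler0 /mstep lext0 scaler0.
- by rewrite scalerDr !mstepD IHu IHv scalerDr.
- by rewrite -[<< d *g x >>]/(omon (Some x) d) omonZ !mstep_omon omonZ.
Qed.

Definition wmon w u := foldr mstep u w.

Lemma wmonD w : {morph wmon w : u v / u + v}.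
Proof. by move=> u v; elim: w => //= b w ->; apply: mstepD. Qed.

Lemma wmonZ w c u : wmon w (c *: u) = c *: wmon w u.
Proof. by elim: w => //= b w ->; apply: mstepZ. Qed.

Lemma wmon0 w : wmon w 0 = 0.
Proof. by have := wmonZ w 0 0; rewrite !scale0r. Qed.

Lemma wmon_nilp u : wmon (nseq r.+1 true) u = 0.
Proof.
elim/malg_ind: u => [|u v IHu IHv|c x]; first exact: wmon0.
  by rewrite wmonD IHu IHv addr0.
have h n o : wmon (nseq n true) (omon o c) = omon (iter n (obind (mon_step true)) o) c.
  by elim: n => //= n ->; apply: mstep_omon.
by rewrite -[<< c *g x >>]/(omon (Some x) c) h mon_nilp.
Qed.

Lemma freeAlg_ind (Q : freeAlg k -> Prop) :
  Q 0 -> (forall a b, Q a -> Q b -> Q (a + b)) ->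
  (forall c (a : {fmonom bool}), Q << c *g a >>) -> forall a, Q a.
Proof. exact: malg_ind. Qed.

Definition fact (a : freeAlg k) u : {malg k[K]} :=
  lext (fun (w : {fmonom bool}) c => c *: wmon (w : seq bool) u) a.

Lemma fact_add u : additive_family (fun (w : {fmonom bool}) c => c *: wmon (w : seq bool) u).
Proof. by move=> w c d; apply: scalerDl. Qed.

Lemma factDl u : {morph fact^~ u : a b / a + b}.
Proof. exact: (lextD (@fact_add u)). Qed.

Lemma fact0l u : fact 0 u = 0. Proof. exact: lext0. Qed.

Lemma factU c (w : {fmonom bool}) u : fact << c *g w >> u = c *: wmon w u.
Proof. by rewrite /fact lextU //; apply: fact_add. Qed.

Lemma factDr a : {morph fact a : u v / u + v}.
Proof.
move=> u v; rewrite /fact unlock -big_split; apply: eq_bigr => w _.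
by rewrite wmonD scalerDr.
Qed.

Lemma fact0r a : fact a 0 = 0.
Proof. by apply: (addrI (fact a 0)); rewrite -factDr !addr0. Qed.

Lemma factM a b u : fact (a * b) u = fact a (fact b u).
Proof.
elim/freeAlg_ind: a => [|a a' IHa IHa'|c w]; first by rewrite mul0r !fact0l.
  rewrite mulrDl (factDl u) (factDl (fact b u)); exact: congr2 IHa IHa'.
elim/freeAlg_ind: b => [|b b' IHb IHb'|d w'].
- by rewrite mulr0 !fact0l fact0r.
- rewrite mulrDr [LHS](factDl u) [in RHS](factDl u) factDr; exact: congr2 IHb IHb'.
rewrite [_ * _]malgM_def fgmulUU !factU wmonZ scalerA.
by rewrite fmM /wmon foldr_cat.
Qed.

Lemma fact1 u : fact 1 u = u.
Proof. by rewrite [fact _ _]factU scale1r fm1. Qed.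

Lemma factZ c a u : fact (c *: a) u = c *: fact a u.
Proof.
elim/freeAlg_ind: a => [|a a' IHa IHa'|d w].
- by rewrite scaler0 fact0l scaler0.
- rewrite scalerDr [LHS](factDl u) [in RHS](factDl u) scalerDr; exact: congr2 IHa IHa'.
have -> : c *: << d *g w >> = << c * d *g w >> :> freeAlg k by exact: malgZU.
by rewrite !factU; apply/esym/scalerA.
Qed.

Lemma fact_letterX n b u : fact (letter k b ^+ n) u = wmon (nseq n b) u.
Proof.
elim: n => [|n IH]; first exact: fact1.
by rewrite exprS factM IH factU scale1r fmU.
Qed.

(** This is what makes the action of the free algebra descend to its quotient. *)
Lemma fact_ideal a u : a \in genIdeal (letter k true ^+ r.+1) -> fact a u = 0.
Proof.
move=> /genIdealP[n [v [v' ->]]].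
rewrite (big_morph (fact^~ u) (factDl u) (fact0l u)) big1 // => i _.
by rewrite !factM fact_letterX wmon_nilp fact0r.
Qed.

Definition monmod_sort : Type := {malg k[K]}.
HB.instance Definition _ := GRing.Zmodule.on monmod_sort.

Definition mon_scale (b : gradedB k r) (u : monmod_sort) : monmod_sort :=
  fact (repr (b : algB k r)) u.

Lemma mon_scale_toB a u : mon_scale (toB r a) u = fact a u.
Proof.
rewrite /mon_scale -[repr _](subrK a) factDl fact_ideal ?add0r //.
exact: repr_toQuot.
Qed.

Lemma toB_surj (b : gradedB k r) : exists a, b = toB r a.
Proof. by exists (repr (b : algB k r)); rewrite /toB toQuot_repr. Qed.

Lemma mon_scaleA (a b : gradedB k r) u :
  mon_scale a (mon_scale b u) = mon_scale (a * b) u.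
Proof.
have [[a' ->] [b' ->]] := (toB_surj a, toB_surj b).
by rewrite -toBM !mon_scale_toB factM.
Qed.

Lemma mon_scale1 : left_id 1 mon_scale.
Proof. by move=> u; rewrite -[1]/(toB r 1) mon_scale_toB fact1. Qed.

Lemma mon_scaleDr : right_distributive mon_scale +%R.
Proof. by move=> b u v; apply: factDr. Qed.

Lemma mon_scaleDl u : {morph mon_scale^~ u : a b / a + b}.
Proof.
move=> a b; have [[a' ->] [b' ->]] := (toB_surj a, toB_surj b).
by rewrite -toBD !mon_scale_toB factDl.
Qed.

HB.instance Definition _ := GRing.Zmodule_isLmodule.Build (gradedB k r) monmod_sort
  mon_scaleA mon_scale1 mon_scaleDr mon_scaleDl.

Lemma mon_scal c (u : monmod_sort) : c%:A *: u = (c *: (u : {malg k[K]}) : {malg k[K]}).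
Proof.
change (mon_scale (c *: toB r 1) u = (c *: (u : {malg k[K]}) : {malg k[K]})).
by rewrite -toBZ mon_scale_toB factZ fact1.
Qed.

Lemma mon_gen (b : bool) (u : monmod_sort) :
  fg_gen (b : fg_index (gradedB k r)) *: u = mstep b u.
Proof.
change (mon_scale (toB r (letter k b)) u = mstep b u).
by rewrite mon_scale_toB -[letter k b]expr1 fact_letterX.
Qed.

Notation mon_part := (malg_part (@mon_deg r K)).

Lemma mon_part_step i b u : mon_part (1 + i) (mstep b u) = mstep b (mon_part i u).
Proof.
elim/malg_ind: u => [|u v IHu IHv|c x].
- by rewrite /mstep malg_part0 !lext0 malg_part0.
- by rewrite mstepD !malg_partD IHu IHv mstepD.
rewrite malg_partU mstepU; case E: (mon_step b x) => [y|] /=; last first.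
  by rewrite malg_part0; case: eqP => _; [rewrite mstepU E | rewrite /mstep lext0].
rewrite malg_partU (mon_deg_step E) (inj_eq (addrI 1)).
by case: eqP => _; [rewrite mstepU E | rewrite /mstep lext0].
Qed.

Lemma mon_partZ (d : int) (b : gradedB k r) i (u : monmod_sort) : homog d b ->
  mon_part (d + i) (b *: u) = b *: (mon_part i u : monmod_sort).
Proof.
have partZk j c (v : monmod_sort) : mon_part j (c%:A *: v) = c%:A *: (mon_part j v : monmod_sort).
  rewrite !mon_scal; apply/malgP => x.
  by rewrite mcoeffZ !malg_part_coef mcoeffZ; case: eqP; rewrite ?mulr0.
have partw (w : seq bool) j (v : monmod_sort) :
    mon_part ((size w)%:Z + j) (\prod_(a <- w) fg_gen (a : fg_index (gradedB k r)) *: v) =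
    \prod_(a <- w) fg_gen (a : fg_index (gradedB k r)) *: (mon_part j v : monmod_sort).
  elim: w v j => [|a w IH] v j; first by rewrite !big_nil !scale1r add0r.
  by rewrite !big_cons -!scalerA -IH !mon_gen -mon_part_step addrA -PoszD add1n.
move=> [s sd ->]; rewrite !scaler_suml.
rewrite (big_morph (mon_part (d + i)) (malg_partD _ _) (malg_part0 _ _ _)).
apply: eq_big_seq => -[c w] /(allP sd)/eqP <-.
rewrite -mulr_algl -!scalerA partZk.
exact: (congr1 (fun v : monmod_sort => c%:A *: v) (partw w i u)).
Qed.

Definition monmod : grmod (gradedB k r) :=
  @GrMod k (gradedB k r) monmod_sort mon_part (malg_partD (@mon_deg r K))
    (malg_part_part (@mon_deg r K)) (malg_part_sum (@mon_deg r K)) mon_partZ.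

End MonomialModule.

(** A graded linear map on the span of a set [S] of basis vectors that is stable
    under the letters. Partial maps are needed because a morphism modulo torsion
    out of a free module is only given far enough from the generators. *)
Section MonomialMaps.
Variables (k : fieldType) (r : nat) (K : monact r) (M : grmod (gradedB k r)).
Variable phi : K -> M.
Implicit Types (c d : k) (x y : K) (u v : monmod k K).

Definition mon_ext u : M := lext (fun x c => c%:A *: phi x) u.

Lemma mon_ext_add : additive_family (fun x (c : k) => c%:A *: phi x).
Proof. by move=> x; apply: scalkD. Qed.

Lemma mon_extD : {morph mon_ext : u v / u + v}.
Proof. exact: (lextD mon_ext_add). Qed.

Lemma mon_extU c x : mon_ext << c *g x >> = c%:A *: phi x.
Proof. exact: (lextU mon_ext_add). Qed.

Lemma mon_ext0 : mon_ext 0 = 0. Proof. exact: lext0. Qed.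

Lemma mon_extZ c u : mon_ext (c%:A *: u) = c%:A *: mon_ext u.
Proof.
rewrite mon_scal; elim/malg_ind: u => [|u v IHu IHv|d x].
- by rewrite scaler0 mon_ext0 scaler0.
- by rewrite scalerDr !mon_extD IHu IHv scalerDr.
rewrite -[<< d *g x >>]/(omon (Some x) d) omonZ !mon_extU.
exact: scalkA.
Qed.

Variable S : K -> Prop.
Hypothesis S_step : forall b x y, S x -> mon_step b x = Some y -> S y.
Hypothesis phi_deg : forall x, S x -> part (mon_deg x) (phi x) = phi x.
Hypothesis phi_step : forall b x, S x ->
  fg_gen (b : fg_index (gradedB k r)) *: phi x = if mon_step b x is Some y then phi y else 0.

Definition supported u := forall x, x \in msupp (u : {malg k[K]}) -> S x.

Lemma supportedD u v : supported u -> supported v -> supported (u + v).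
Proof.
move=> Su Sv x /(fsubsetP (msuppD_le _ _)); rewrite in_fsetU => /orP[/Su|/Sv] //.
Qed.

Lemma supported0 : supported 0.
Proof. by move=> x; rewrite msupp0. Qed.

Lemma supportedU c x : S x -> supported << c *g x >>.
Proof. by move=> Sx y /(fsubsetP msuppU_le); rewrite in_fset1 => /eqP->. Qed.

Lemma supported_ind (Q : monmod k K -> Prop) :
  Q 0 -> (forall u v, Q u -> Q v -> Q (u + v)) ->
  (forall c x, S x -> Q << c *g x >>) -> forall u, supported u -> Q u.
Proof. exact: malg_supp_ind. Qed.

Lemma supported_gsub : is_gsub supported.
Proof.
split; [exact: supported0 | exact: supportedD | |].
- apply: subspace_closedZ; [exact: supported0 | exact: supportedD | |].
    move=> c u Su x; rewrite mon_scal => /(fsubsetP (msuppZ_le _ _)); exact: Su.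
  move=> b; apply: supported_ind => [|u v Su Sv|c x Sx].
  + by rewrite scaler0; apply: supported0.
  + by rewrite scalerDr; apply: supportedD.
  rewrite mon_gen mstepU; case E: (mon_step b x) => [y|] /=; last exact: supported0.
  exact/supportedU/(S_step Sx E).
- move=> i u Su x; rewrite -mcoeff_neq0 [X in X != 0]malg_part_coef.
  have [_ ux|_ /eqP//] := eqVneq (mon_deg x) i.
  by apply: Su; rewrite -mcoeff_neq0.
Qed.

Lemma mon_ext_rel : is_grel (fun u m => supported u /\ mon_ext u = m).
Proof.
have gS := supported_gsub.
split=> [|u v _ _ [Su <-] [Sv <-]|b u _ [Su <-]|i u _ [Su <-]].
- by split; [apply: supported0 | apply: mon_ext0].
- by split; [apply: supportedD | apply: mon_extD].
- split; first exact: (gsubZ gS).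
  pose Q (p : prod_mod (monmod k K) M) := supported p.1 /\ mon_ext p.1 = p.2.
  suff: Q (b *: (u, mon_ext u)) by case.
  apply: (@subspace_closedZ _ _ (prod_mod (monmod k K) M) Q) => //.
  + by split; [apply: supported0 | apply: mon_ext0].
  + by move=> p q [Sp Ep] [Sq Eq]; split; [apply: supportedD | rewrite /= -Ep -Eq; apply: mon_extD].
  + by move=> c p [Sp Ep]; split; [exact: (gsubZ gS) | rewrite /= -Ep; apply: mon_extZ].
  move=> {Su}b' [{}u m] [/= Su <-]; split; first exact: (gsubZ gS).
  change (mon_ext (fg_gen b' *: u) = fg_gen b' *: mon_ext u).
  elim/supported_ind: u / Su => [|v v' IH IH'|c x Sx].
  + by rewrite scaler0 mon_ext0 scaler0.
  + by rewrite scalerDr !mon_extD IH IH' scalerDr.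
  rewrite mon_gen mstepU mon_extU scalkCA phi_step //.
  by case: (mon_step b' x) => [y|] /=; rewrite ?mon_extU // mon_ext0 scaler0.
- split; first exact: (gsub_part gS).
  rewrite /=; elim/supported_ind: u / Su => [|v v' IH IH'|c x Sx].
  + by rewrite malg_part0 mon_ext0 part0.
  + by rewrite malg_partD !mon_extD IH IH' partD.
  rewrite malg_partU mon_extU part_scal; have [<-|ni] := eqVneq (mon_deg x) i.
    by rewrite mon_extU phi_deg.
  by rewrite mon_ext0 -(phi_deg Sx) part_part eq_sym (negPf ni) scaler0.
Qed.

End MonomialMaps.

(** * Free modules are projective modulo torsion *)

Section Words.
Variables (k : fieldType) (r : nat).
Notation B := (gradedB k r).
Implicit Types (w : seq bool) (a b : 'I_r.+1) (s : seq 'I_r.+1).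

(** The word [t_a1 ... t_an], where [t_a = x y^a]. *)
Definition tword s : seq bool := flatten [seq false :: nseq a true | a : 'I_r.+1 <- s].

(** The word [y^b t_a1 ... t_an]. *)
Definition yword b s : seq bool := nseq b true ++ tword s.

Lemma tword_cat s s' : tword (s ++ s') = tword s ++ tword s'.
Proof. by rewrite /tword map_cat flatten_cat. Qed.

Lemma size_tword_ge s : (size s <= size (tword s))%N.
Proof. by elim: s => //= a s IH; rewrite size_cat ltnS (leq_trans IH) ?leq_addl. Qed.

Lemma size_tword_le s : (size (tword s) <= r.+1 * size s)%N.
Proof.
elim: s => [|a s IH] /=; first by rewrite muln0.
have := ltn_ord a; rewrite size_cat size_nseq mulnS -/(tword s); lia.
Qed.

Lemma y_nilp (M : grmod B) (m : M) : wact (nseq r.+1 true : seq (fg_index B)) m = 0.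
Proof.
have h n : wact (nseq n true : seq (fg_index B)) m = (toB r (letter k true ^+ n) : B) *: m.
  elim: n => [|n IH]; first by rewrite scale1r.
  by rewrite /= IH scalerA exprS toBM.
rewrite h; suff -> : toB r (letter k true ^+ r.+1) = 0 :> algB k r by rewrite scale0r.
rewrite -toB0; apply/toQuot_eq/genIdealP.
by exists 1%N, (fun=> 1), (fun=> 1); rewrite big_ord1 mul1r mulr1 subr0.
Qed.

(** A letter x in front of [y^b t_a1 ... t_an] gives [t_b t_a1 ... t_an], and a
    letter y raises b until [y^(r+1)] appears. *)
Lemma word_normal w : (forall (M : grmod B) (m : M), wact (w : seq (fg_index B)) m = 0) \/
  exists b s, w = yword b s.
Proof.
elim: w => [|c w [w0|[b [s ->]]]]; first by right; exists ord0, [::].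
  by left => M m /=; rewrite w0 scaler0.
case: c; last by right; exists ord0, (b :: s).
have [br|br] := ltnP b r; first by right; exists (Ordinal (br : b.+1 < r.+1)%N), s.
have bE : nat_of_ord b = r by have := ltn_ord b; lia.
by left => M m; rewrite /yword bE -[true :: _]/(nseq r.+1 true ++ tword s) act_cat y_nilp.
Qed.

Lemma yword_rcons b s a : yword b (rcons s a) = yword b s ++ tword [:: a].
Proof. by rewrite -cats1 /yword tword_cat catA. Qed.

(** A word that acts nontrivially and has length (r+1)(n+1) contains at least n
    factors [t_a]: each of them has at most r+1 letters, and at most r letters
    remain in front. So torsion may be tested on the free monoid of the [t_a]. *)
Lemma absorbed_tword (M : grmod B) (Q : M -> Prop) (m : M) n : is_gsub Q ->
  (forall s, size s = n -> Q (wact (tword s : seq (fg_index B)) m)) -> absorbed Q m.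
Proof.
move=> gQ Qs; exists (r.+1 * n.+1)%N => w sw.
have [->|[b [s wE]]] := word_normal w; first exact: gsub0.
have ns : (n <= size s)%N.
  have := size_tword_le s; have : size w = (b + size (tword s))%N.
    by rewrite wE size_cat size_nseq.
  by have := ltn_ord b; nia.
rewrite wE act_cat -(cat_take_drop (size s - n) s) tword_cat act_cat.
do 2!apply: (gsub_act _ gQ); apply: Qs.
by rewrite size_drop; lia.
Qed.

End Words.

Section FreeModule.
Variables (k : fieldType) (r : nat) (I : choiceType) (deg : I -> int).
Notation B := (gradedB k r).
Implicit Types (a b : 'I_r.+1) (s : seq 'I_r.+1) (i : I).

(** The triple [(b, s, i)] stands for [y^b t_s1 ... t_sn] applied to the generator
    i; by [word_normal] these monomials span the free module. *)
Definition free_index : choiceType := (('I_r.+1 * seq 'I_r.+1) * I)%type.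
Implicit Types x y : free_index.

Definition free_deg x : int := (size (yword x.1.1 x.1.2))%:Z + deg x.2.

Definition free_step (c : bool) x : option free_index :=
  if c then omap (fun b => (b, x.1.2, x.2)) (insub x.1.1.+1)
  else Some (ord0, x.1.1 :: x.1.2, x.2).

Lemma free_deg_step c x y : free_step c x = Some y -> free_deg y = 1 + free_deg x.
Proof.
case: x => [[b s] i]; case: c => /= [|[<-]].
  case: insubP => //= b' _ b'E [<-]; rewrite /free_deg /yword /= b'E /=.
  by rewrite addrA -PoszD.
by rewrite /free_deg /yword /= addrA -PoszD.
Qed.

Lemma iter_free_step n b s i :
  iter n (obind (free_step true)) (Some (b, s, i)) =
  omap (fun b => (b, s, i)) (insub (n + b)%N).
Proof.
elim: n => [|n IH] /=; first by rewrite add0n valK.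
rewrite IH; case: insubP => [b' _ b'E|] /=; first by rewrite /free_step /= b'E.
by rewrite -leqNgt => nb; rewrite insubN // -leqNgt ltnW.
Qed.

Lemma free_nilp x : iter r.+1 (obind (free_step true)) (Some x) = None.
Proof. by case: x => -[b s] i; rewrite iter_free_step insubN // -leqNgt leq_addr. Qed.

Definition free_monact : monact r := MonAct free_deg_step free_nilp.
Definition freemod : grmod B := monmod k free_monact.

Definition fmon (c : k) x : freemod := << c *g x >>.

Lemma fmonZ (c : k) x : fmon c x = c%:A *: fmon 1 x.
Proof. by rewrite mon_scal [RHS]malgZU mulr1. Qed.

Lemma fmon_scal (c d : k) x : c%:A *: fmon d x = fmon (c * d) x.
Proof. by rewrite [LHS]mon_scal; apply: malgZU. Qed.

Definition fcoef x (u : freemod) : k := (u : {malg k[free_index]})@_x.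

Lemma fcoefD x : {morph fcoef x : u v / u + v}.
Proof. exact: mcoeffD. Qed.

Lemma fcoef0 x : fcoef x 0 = 0.
Proof. exact: mcoeff0. Qed.

Lemma fcoefN x : {morph fcoef x : u / - u}.
Proof. exact: mcoeffN. Qed.

Lemma fcoefZ x c u : fcoef x (c%:A *: u) = c * fcoef x u.
Proof. by rewrite /fcoef mon_scal; apply: mcoeffZ. Qed.

Lemma fcoef_fmon c x y : fcoef y (fmon c x) = c *+ (x == y).
Proof. exact: mcoeffU. Qed.

Lemma fmonD c d x : fmon (c + d) x = fmon c x + fmon d x.
Proof. exact: monalgUD. Qed.

Lemma freemod_ind (Q : freemod -> Prop) :
  Q 0 -> (forall u v, Q u -> Q v -> Q (u + v)) ->
  (forall c x, Q (fmon c x)) -> forall u, Q u.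
Proof. exact: malg_ind. Qed.

Lemma freemod_supp_ind (S : free_index -> Prop) (Q : freemod -> Prop) :
  Q 0 -> (forall u v, Q u -> Q v -> Q (u + v)) ->
  (forall c x, S x -> Q (fmon c x)) ->
  forall u, (forall x, fcoef x u != 0 -> S x) -> Q u.
Proof.
move=> Q0 QD QU u uS; apply: (malg_supp_ind Q0 QD QU) => x xu.
by apply: uS; rewrite /fcoef mcoeff_neq0.
Qed.

Lemma fcoef_inj u : (forall x, fcoef x u = 0) -> u = 0.
Proof. by move=> u0; apply/malgP => x; rewrite mcoeff0; apply: u0. Qed.

Lemma fcoef_finite u : exists s : seq free_index, forall x, (x \in s) = (fcoef x u != 0).
Proof.
exists (finmap.enum_fset (msupp (u : {malg k[free_index]}))) => x.
by rewrite /fcoef mcoeff_neq0.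
Qed.

Lemma freemod_additive_eq (V : zmodType) (f g : freemod -> V) :
  {morph f : u v / u + v} -> {morph g : u v / u + v} ->
  (forall c x, f (fmon c x) = g (fmon c x)) -> f =1 g.
Proof. exact: malg_additive_eq. Qed.

Lemma fmon_step (c : bool) (d : k) x :
  fg_gen (c : fg_index B) *: fmon d x = if free_step c x is Some y then fmon d y else 0.
Proof. by rewrite mon_gen [LHS]mstepU /=; case: (free_step c x). Qed.

Lemma fmon_yword (c : k) b s s' i :
  wact (yword b s : seq (fg_index B)) (fmon c (ord0, s', i)) = fmon c (b, s ++ s', i).
Proof.
have y_act n (lt_n : (n < r.+1)%N) t :
    wact (nseq n true : seq (fg_index B)) (fmon c (ord0, t, i)) = fmon c (Ordinal lt_n, t, i).
  elim: n lt_n => [|n IH] lt_n.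
    by congr (fmon _ (_, _, _)); apply: val_inj.
  rewrite -[nseq _ _]/(true :: nseq n true) [LHS]/= (IH (ltnW lt_n)) fmon_step /free_step.
  rewrite insubT /=; congr (fmon _ (_, _, _)); exact: val_inj.
rewrite act_cat.
have -> : wact (tword s : seq (fg_index B)) (fmon c (ord0, s', i)) = fmon c (ord0, s ++ s', i).
  elim: s => [|a s IH] //.
  rewrite -[tword _]/(false :: (nseq a true ++ tword s)) [LHS]/= act_cat IH.
  by rewrite (y_act a (ltn_ord a)) fmon_step /=; congr (fmon _ (_, _ :: _, _)); apply: val_inj.
by rewrite (y_act b (ltn_ord b)); congr (fmon _ (_, _, _)); apply: val_inj.
Qed.

(** Values [e i s] are prescribed on the elements [t_s1 ... t_sn] of the generator
    i with [n = lev i]. For fixed n these elements are independent over B,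
    so the prescription can be arbitrary. *)
Section Extension.
Variables (M : grmod B) (lev : I -> nat) (e : I -> seq 'I_r.+1 -> M).
Hypothesis e_deg : forall i s, size s = lev i ->
  part ((size (tword s))%:Z + deg i) (e i s) = e i s.

Definition above x : Prop := (lev x.2 <= size x.1.2)%N.

Definition free_val x : M :=
  let n := (size x.1.2 - lev x.2)%N in
  wact (yword x.1.1 (take n x.1.2) : seq (fg_index B)) (e x.2 (drop n x.1.2)).

Lemma above_step (c : bool) x y : above x -> free_step c x = Some y -> above y.
Proof.
case: x => [[b s] i]; rewrite /above; case: c => /= [ls|ls [<-]].
  by case: insubP => //= b' _ _ [<-].
by rewrite /= ltnW.
Qed.

Lemma free_val_deg x : above x -> part (free_deg x) (free_val x) = free_val x.
Proof.
case: x => [[b s] i]; rewrite /above /free_val /free_deg /= => ls.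
set n := (_ - _)%N; have sd : size (drop n s) = lev i by rewrite size_drop subKn.
rewrite -[in RHS](e_deg sd) -part_act; congr part.
by rewrite addrA -PoszD /yword -size_cat -catA -tword_cat cat_take_drop.
Qed.

Lemma free_val_step (c : bool) x : above x ->
  fg_gen (c : fg_index B) *: free_val x =
  if free_step c x is Some y then free_val y else 0.
Proof.
case: x => [[b s] i]; rewrite /above /free_val /= => ls.
case: c; last by rewrite /= subSn //.
rewrite /free_step /=; case: insubP => [b' _ b'E|] /=; first by rewrite /yword b'E.
rewrite -leqNgt => br.
have bE : nat_of_ord b = r by have := ltn_ord b; lia.
rewrite /yword bE; set s' := take _ _; set m := e _ _.
by rewrite -[LHS]/(wact (nseq r.+1 true ++ tword s' : seq (fg_index B)) m) act_cat y_nilp.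
Qed.

Definition free_ext := @mon_ext k r free_monact M free_val.

Lemma free_ext0 : free_ext 0 = 0.
Proof. exact: mon_ext0. Qed.

Lemma free_extD (u v : freemod) : free_ext (u + v) = free_ext u + free_ext v.
Proof. exact: mon_extD. Qed.

Lemma free_ext_fmon c x : free_ext (fmon c x) = c%:A *: free_val x.
Proof. exact: mon_extU. Qed.

Lemma free_ext_rel :
  is_grel (fun u m => @supported k r free_monact above u /\ free_ext u = m).
Proof. exact: (@mon_ext_rel k r free_monact M free_val above above_step free_val_deg free_val_step). Qed.

(** Each [t_a] raises the number of factors by one, while y leaves it unchanged. *)
Lemma absorbed_above (u : freemod) :
  absorbed (@supported k r free_monact above : freemod -> Prop) u.
Proof.
have gS : is_gsub (@supported k r free_monact above : freemod -> Prop).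
  exact: (@supported_gsub k r free_monact above above_step).
have gA := absorbed_gsub gS.
elim/malg_ind: u => [|u v|c [[b s] i]]; [exact: (gsub0 gA) | exact: (gsubD gA) |].
apply: (absorbed_tword gS (n := lev i)) => t st.
suff [o [-> Ho]] : exists o : option free_index,
   wact (tword t : seq (fg_index B)) (fmon c (b, s, i)) = @omon k r free_monact o c /\
   forall y, o = Some y -> y.2 = i /\ (size t <= size y.1.2)%N.
  case: o Ho => [y|] Ho /=; last exact: supported0.
  by apply: supportedU; have [] := Ho y erefl; rewrite /above st => ->.
elim: t {st} => [|a t [o [E Ho]]]; first by exists (Some (b, s, i)); split=> // y [<-].
have step (d : bool) o' : fg_gen (d : fg_index B) *: (@omon k r free_monact o' c : freemod) =
    @omon k r free_monact (obind (free_step d) o') c.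
  by rewrite mon_gen [LHS]mstep_omon.
have [o' [E' Ho']] : exists o' : option free_index,
    wact (nseq a true ++ tword t : seq (fg_index B)) (fmon c (b, s, i)) =
      @omon k r free_monact o' c /\
    forall y, o' = Some y -> y.2 = i /\ (size t <= size y.1.2)%N.
  elim: (nat_of_ord a) => [|n [o' [E' Ho']]]; first by exists o.
  exists (obind (free_step true) o'); split; first by rewrite /= E' step.
  move=> y; case: o' Ho' {E'} => //= x /(_ x erefl)[xi xs].
  by rewrite /free_step; case: insubP => //= b' _ _ [<-].
exists (obind (free_step false) o'); split.
  by rewrite -[tword _]/(false :: (nseq a true ++ tword t)) [LHS]/= E' step.
move=> y; case: o' Ho' {E'} => //= x /(_ x erefl)[xi xs] [<-] /=.
by rewrite ltnS.
Qed.

Lemma free_ext_lift (H : freemod -> M -> Prop) : is_grel H ->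
  (forall i s, size s = lev i ->
     H (wact (tword s : seq (fg_index B)) (fmon 1 (ord0, [::], i))) (e i s)) ->
  exists g : qhom freemod M, forall u m, g u m -> H u m /\ free_ext u = m.
Proof.
move=> gH He; have [u|m [_ <-]|g gE] := absorbed_grelP free_ext_rel.
- by apply: absorbed_sub (absorbed_above u) => v Sv; exists (free_ext v).
- by rewrite free_ext0; apply: torsel0.
exists g => u m; rewrite gE => -[Su <-]; split=> //.
apply: (@supported_ind k r free_monact above (fun u : freemod => H u (free_ext u))) Su.
- by rewrite free_ext0; apply: (grel0 gH).
- by move=> {m}u' v Hu Hv; rewrite free_extD; apply: (grelD gH Hu Hv).
move=> c x Ax; rewrite -[<< c *g x >>]/(fmon c x) free_ext_fmon fmonZ; apply: (grelZ gH).
case: x Ax => [[b s] i]; rewrite /above /free_val /= => ls.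
rewrite -[s in fmon 1 (b, s, i)](cat_take_drop (size s - lev i)) -fmon_yword.
apply: grel_act => //; rewrite -(cats0 (drop _ s)).
have := He i (drop (size s - lev i) s); rewrite size_drop subKn // => /(_ erefl).
suff -> : wact (tword (drop (size s - lev i) s) : seq (fg_index B)) (fmon 1 (ord0, [::], i)) =
  fmon 1 (ord0, drop (size s - lev i) s ++ [::], i) by rewrite cats0.
exact: (fmon_yword 1 ord0).
Qed.

End Extension.

(** The relation [p^-1 f] has a large domain but too large an indeterminacy. For
    each generator, its values may be chosen freely on the finitely many
    [t_s1 ... t_sn] of a length n at which it is defined, and the choices extend
    to a map on the monomials with at least n factors by freeness. *)
Lemma freemod_projective : qprojective freemod.
Proof.
move=> Y Z p p_epi f; set H := fun u e => exists2 z, f u z & p e z.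
have gH : is_grel H := comp_grel (graph_rel f) (conv_grel (graph_rel p)).
have dH u : absorbed (qdom H) u.
  have gd := gsub_dom gH.
  apply: (absorbed_trans gd (absorbed_dom f u)) => {}u [z fz].
  apply: (absorbed_sub _ (absorbed_along fz (p_epi z))).
  by move=> u' [z' fz' [y py]]; exists y, z'.
have /choice[lev Hlev] : forall i, exists n, forall s, size s = n ->
    qdom H (wact (tword s : seq (fg_index B)) (fmon 1 (ord0, [::], i))).
  move=> i; have [n Hn] := dH (fmon 1 (ord0, [::], i)); exists n => s sn.
  apply: (tors_ge (gsub_dom gH) _ Hn erefl); rewrite -sn; exact: size_tword_ge.
have /choice[e He] : forall x : I * seq 'I_r.+1, exists y : Y, size x.2 = lev x.1 ->
    H (wact (tword x.2 : seq (fg_index B)) (fmon 1 (ord0, [::], x.1))) y /\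
    part ((size (tword x.2))%:Z + deg x.1) y = y.
  move=> [i s]; have [/Hlev[y Hy]|ns] := eqVneq (size s) (lev i); last first.
    by exists 0 => E; rewrite E eqxx in ns.
  (* Projecting to the expected degree makes the chosen value homogeneous. *)
  exists (part ((size (tword s))%:Z + deg i) y) => _; split; last by rewrite part_part eqxx.
  have := grel_part gH ((size (tword s))%:Z + deg i) Hy; rewrite part_act.
  by rewrite [part _ (fmon _ _)]malg_partU /= /free_deg /= add0r eqxx.
have [i s /(He (i, s))[_ //]|i s /(He (i, s))[]//|g Hg] := @free_ext_lift Y lev (fun i s => e (i, s)) _ H gH _.
exists g; apply/qeq_torselP => u z z' [y /Hg[[z1 fz1 py1] _] py] fz'.
rewrite -[z](subrK z1) -addrA; apply: torselD; first exact: qhom_det py py1.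
exact: qhom_det fz1 fz'.
Qed.

Section FreeMap.
Variables (M : grmod B) (m : I -> M).
Hypothesis m_deg : forall i, part (deg i) (m i) = m i.

Definition free_map : freemod -> M := free_ext (fun=> 0%N) (fun i _ => m i).

Lemma free_map0 : free_map 0 = 0. Proof. exact: free_ext0. Qed.

Lemma free_mapD u v : free_map (u + v) = free_map u + free_map v.
Proof. exact: free_extD. Qed.

Lemma free_map_fmon c b s i :
  free_map (fmon c (b, s, i)) = c%:A *: wact (yword b s : seq (fg_index B)) (m i).
Proof. by rewrite [LHS]free_ext_fmon /free_val /= subn0 take_size. Qed.

Lemma free_map_rel : is_grel (fun u n => free_map u = n).
Proof.
have e_deg i s : size s = 0%N -> part ((size (tword s))%:Z + deg i) (m i) = m i.
  by move/size0nil->; rewrite add0r m_deg.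
have gG := free_ext_rel e_deg; split=> [|u v _ _ <- <-|b u _ <-|i u _ <-].
- exact: free_map0.
- exact: free_mapD.
- by have [] := grelZ gG b (conj (fun _ _ => leq0n _) (erefl (free_map u))).
- by have [] := grel_part gG i (conj (fun _ _ => leq0n _) (erefl (free_map u))).
Qed.

Lemma free_map_act (w : seq (fg_index B)) u : free_map (wact w u) = wact w (free_map u).
Proof. exact: (grel_act free_map_rel w (erefl (free_map u))). Qed.

Lemma free_mapB u v : free_map (u - v) = free_map u - free_map v.
Proof. exact: (grelB free_map_rel (erefl (free_map u)) (erefl (free_map v))). Qed.

End FreeMap.

End FreeModule.

(** * A graded linear choice of coordinates *)

Section HomogeneousCoordinates.
Variables (k : fieldType) (B : fgAlg k) (M : grmod B).

(** Homogeneous elements together with a degree, since 0 has every degree. *)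
Definition helt : choiceType := {p : int * M | part p.1 p.2 == p.2}.
Definition hdeg (i : helt) : int := (val i).1.
Definition hval (i : helt) : M := (val i).2.
Implicit Types (u v : {malg k[helt]}) (i : helt) (c : k).

Lemma hval_deg i : part (hdeg i) (hval i) = hval i.
Proof. exact: eqP (valP i). Qed.

Definition hev u : M := lext (fun i c => c%:A *: hval i) u.

Lemma hev_add : additive_family (fun i (c : k) => c%:A *: hval i).
Proof. by move=> i; apply: scalkD. Qed.

Lemma hevD : {morph hev : u v / u + v}. Proof. exact: (lextD hev_add). Qed.

Lemma hev0 : hev 0 = 0. Proof. exact: lext0. Qed.

Lemma hevN : {morph hev : u / - u}. Proof. exact: (lextN hev_add). Qed.

Lemma hevU c i : hev << c *g i >> = c%:A *: hval i.
Proof. exact: (lextU hev_add). Qed.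

Lemma hevZ c u : hev (c *: u) = c%:A *: hev u.
Proof.
elim/malg_ind: u => [|u v IHu IHv|d i].
- by rewrite scaler0 hev0 scaler0.
- by rewrite scalerDr !hevD IHu IHv scalerDr.
by rewrite malgZU !hevU scalkA.
Qed.

Lemma hev_part d u : hev (malg_part hdeg d u) = part d (hev u).
Proof.
elim/malg_ind: u => [|u v IHu IHv|c i].
- by rewrite malg_part0 hev0 part0.
- by rewrite malg_partD !hevD IHu IHv partD.
rewrite malg_partU hevU part_scal -[in RHS]hval_deg part_part.
have [->|_] := eqVneq d (hdeg i); first by rewrite hevU hval_deg.
by rewrite hev0 scaler0.
Qed.

Definition supp_in (S : set helt) u := forall i, i \in msupp u -> S i.

Definition independent (S : set helt) := forall u, supp_in S u -> hev u = 0 -> u = 0.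

Lemma supp_inD S u v : supp_in S u -> supp_in S v -> supp_in S (u + v).
Proof.
by move=> Su Sv x /(fsubsetP (msuppD_le _ _)); rewrite in_fsetU => /orP[/Su|/Sv].
Qed.

Lemma supp_inZ S c u : supp_in S u -> supp_in S (c *: u).
Proof. by move=> Su x /(fsubsetP (msuppZ_le _ _))/Su. Qed.

Lemma supp_in0 S : supp_in S 0. Proof. by move=> x; rewrite msupp0. Qed.

(** Supports are finite, so the independence of the union of a chain is tested
    inside a single member. *)
Lemma chain_cover (F : set (set helt)) (s : seq helt) : total_on F subset ->
  (forall i, i \in s -> exists2 X, F X & X i) ->
  s = [::] \/ exists2 X, F X & forall i, i \in s -> X i.
Proof.
move=> totF; elim: s => [|i s IH] sF; [by left | right].
have [X FX Xi] := sF i (mem_head _ _).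
have [j js||[Y FY sY]] := IH; first by apply: sF; rewrite inE js orbT.
  by move=> ->; exists X => // j; rewrite inE => /eqP->.
have [XY|YX] := totF X Y FX FY.
  by exists Y => // j; rewrite inE => /orP[/eqP->|/sY //]; apply: XY.
by exists X => // j; rewrite inE => /orP[/eqP->//|/sY/YX].
Qed.

Lemma max_independent : exists S : set helt,
  independent S /\ forall T, (S `<` T)%classic -> ~ independent T.
Proof.
apply: Zorn_bigcup => F FP totF u uF u0.
have [|s0|[X FX uX]] := @chain_cover F (enum_fset (msupp u)) totF.
- by move=> i /uF[X FX Xi]; exists X.
- apply/malgP => i; rewrite mcoeff0 mcoeff_outdom //.
  by change (i \notin enum_fset (msupp u)); rewrite s0.
exact: FP FX _ uX u0.
Qed.

(** A homogeneous element outside the span could be added to a maximal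
    independent set. *)
Lemma independent_span (S : set helt) : independent S ->
  (forall T, (S `<` T)%classic -> ~ independent T) ->
  forall m, exists2 u, supp_in S u & hev u = m.
Proof.
move=> indS maxS m.
have hom i : exists2 u, supp_in S u & hev u = hval i.
  apply: contrapT => no_u.
  apply: (maxS (S `|` [set i])%classic); first split.
  - by move=> j Sj; left.
  - move=> /(_ i (or_intror erefl)) Si; apply: no_u; exists << i >>.
      by move=> j /(fsubsetP msuppU_le); rewrite in_fset1 => /eqP->.
    by rewrite hevU scal1k.
  move=> u uS u0; pose c := u@_i; pose v := u - << c *g i >>.
  have vS : supp_in S v.
    move=> j; rewrite -mcoeff_neq0 mcoeffB mcoeffU; have [<-|ij] := eqVneq i j.
      by rewrite subrr eqxx.
    by rewrite mulr0n subr0 mcoeff_neq0 => /uS[//|/= ji]; rewrite ji eqxx in ij.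
  have vE : hev v = - (c%:A *: hval i) by rewrite hevD u0 add0r hevN hevU.
  have [c0|c0] := eqVneq c 0.
    have uv : u = v by rewrite /v c0 monalgU0 subr0.
    by apply: indS => //; rewrite uv.
  case: no_u; exists (- c^-1 *: v); first exact: supp_inZ.
  by rewrite hevZ vE scalerN -scalkA mulNr mulVf // !scaleN1r opprK.
have [s _ ->] := part_sum m; elim/big_ind: _ => [|m1 m2 [u Su <-] [v Sv <-]|d _].
- by exists 0; [apply: supp_in0 | apply: hev0].
- by exists (u + v); [apply: supp_inD | apply: hevD].
have md : part d (part d m) == part d m by rewrite part_part eqxx.
exact: hom (exist _ (d, part d m) md).
Qed.

(** Coordinates with respect to a maximal independent set of homogeneous elements
    are unique, hence linear and compatible with degrees. *)
Theorem graded_section : exists s : M -> {malg k[helt]},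
  [/\ {morph s : m n / m + n}, forall c m, s (c%:A *: m) = c *: s m,
      forall d m, part d m = m -> malg_part hdeg d (s m) = s m &
      forall m, hev (s m) = m].
Proof.
have [S [indS /(independent_span indS) spanS]] := max_independent.
have /choice[s sP] : forall m, exists u, supp_in S u /\ hev u = m.
  by move=> m; have [u] := spanS m; exists u.
have uniq_s u v : supp_in S u -> supp_in S v -> hev u = hev v -> u = v.
  move=> Su Sv E; apply/eqP; rewrite -subr_eq0; apply/eqP/indS.
    by rewrite -scaleN1r; apply: supp_inD => //; apply: supp_inZ.
  by rewrite hevD hevN E subrr.
exists s; split=> [m n|c m|d m md|m]; last exact: (sP m).2.
- apply: uniq_s; [exact: (sP _).1 | by apply: supp_inD; apply: (sP _).1 |].
  by rewrite hevD !(sP _).2.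
- apply: uniq_s; [exact: (sP _).1 | by apply: supp_inZ; apply: (sP _).1 |].
  by rewrite hevZ !(sP _).2.
- apply: uniq_s; last by rewrite hev_part !(sP _).2.
    move=> i; rewrite -mcoeff_neq0 malg_part_coef.
    have [_|_ /eqP//] := eqVneq (hdeg i) d.
    by rewrite mcoeff_neq0; apply: (sP m).1.
  exact: (sP m).1.
Qed.

End HomogeneousCoordinates.

(** * The two-term free resolution *)

Section Resolution.
Variables (k : fieldType) (r : nat).
Notation B := (gradedB k r).
Notation tact s m := (wact (tword s : seq (fg_index B)) m).
Notation yact b s m := (wact (yword b s : seq (fg_index B)) m).
Variable M : grmod B.
Notation I := (helt M).
Notation hd := (@hdeg k B M).
Implicit Types (v : {malg k[I]}) (a b : 'I_r.+1) (s t : seq 'I_r.+1) (i : I).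

Variable sec : M -> {malg k[I]}.
Hypothesis secD : {morph sec : m n / m + n}.
Hypothesis secZ : forall c m, sec (c%:A *: m) = c *: sec m.
Hypothesis sec_deg : forall d m, part d m = m -> malg_part hd d (sec m) = sec m.
Hypothesis secK : forall m, hev (sec m) = m.

Lemma sec0 : sec 0 = 0.
Proof. by apply: (addrI (sec 0)); rewrite -secD !addr0. Qed.

Notation gens0 := (freemod k r hd).

(** The left multiple of the combination [v] of generators by the monomial with
    exponent [b] and factors [t]. *)
Definition word_val b t v : gens0 := lext (fun i c => fmon hd c (b, t, i) : gens0) v.

Lemma word_val_add b t : additive_family (fun i (c : k) => fmon hd c (b, t, i) : gens0).
Proof. by move=> i c d; apply: fmonD. Qed.

Lemma word_valD b t : {morph word_val b t : u v / u + v}.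
Proof. exact: (lextD (@word_val_add b t)). Qed.

Lemma word_val0 b t : word_val b t 0 = 0. Proof. exact: lext0. Qed.

Lemma word_valU b t c i : word_val b t << c *g i >> = fmon hd c (b, t, i).
Proof. exact: (lextU (@word_val_add b t)). Qed.

Lemma word_val_coef b t v (x : free_index r I) : x.1.2 != t -> fcoef x (word_val b t v) = 0.
Proof.
move=> xt; apply: (malg_additive_eq (f := fun v => fcoef x (word_val b t v)) (g := fun=> 0)).
- by move=> u w; rewrite word_valD fcoefD.
- by move=> u w; rewrite addr0.
by move=> c i; rewrite word_valU fcoef_fmon (_ : (_ == x) = false) //; apply: contraNF xt => /eqP<-.
Qed.

Lemma word_valZ b t c v : word_val b t (c *: v) = c%:A *: word_val b t v.
Proof.
apply: (malg_additive_eq (f := fun v => word_val b t (c *: v))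
  (g := fun v => c%:A *: word_val b t v)).
- by move=> u w; rewrite scalerDr word_valD.
- by move=> u w; rewrite word_valD scalerDr.
move=> d i; have -> : c *: << d *g i >> = << c * d *g i >> :> {malg k[I]} by exact: malgZU.
by rewrite [LHS]word_valU [in RHS]word_valU fmon_scal.
Qed.

Notation gen_val := (word_val ord0 [::]).

Lemma word_val_act b t v : yact b t (gen_val v) = word_val b t v.
Proof.
apply: (malg_additive_eq (f := fun v => yact b t (gen_val v))).
- by move=> u w; rewrite word_valD actD.
- exact: word_valD.
by move=> c i; rewrite !word_valU fmon_yword cats0.
Qed.

Lemma gen_val_part d v : part d (gen_val v) = gen_val (malg_part hd d v).
Proof.
apply: (malg_additive_eq (f := fun v => part d (gen_val v))
  (g := fun v => gen_val (malg_part hd d v))).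
- by move=> u w; rewrite word_valD partD.
- by move=> u w; rewrite malg_partD word_valD.
move=> c i; rewrite word_valU malg_partU [LHS]malg_partU /= /free_deg /= add0r.
by case: eqP => _; rewrite ?word_valU ?word_val0.
Qed.

Definition eps : gens0 -> M := free_map (@hval k B M).

Lemma epsD (u v : gens0) : eps (u + v) = eps u + eps v. Proof. exact: free_mapD. Qed.

Lemma eps0 : eps 0 = 0. Proof. exact: free_map0. Qed.

Lemma epsB (u v : gens0) : eps (u - v) = eps u - eps v.
Proof. exact: (free_mapB (@hval_deg k B M)). Qed.

Lemma eps_act (w : seq (fg_index B)) (u : gens0) : eps (wact w u) = wact w (eps u).
Proof. exact: (free_map_act (@hval_deg k B M)). Qed.

Lemma eps_rel : is_grel (fun u m => eps u = m).
Proof. exact: (free_map_rel (@hval_deg k B M)). Qed.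

Lemma eps_scal c (u : gens0) : eps (c%:A *: u) = c%:A *: eps u.
Proof. exact: (grelZ eps_rel c%:A (erefl (eps u))). Qed.

Lemma eps_gen v : eps (gen_val v) = hev v.
Proof.
apply: (malg_additive_eq (f := fun v => eps (gen_val v))).
- by move=> u w; rewrite word_valD epsD.
- exact: hevD.
by move=> c i; rewrite word_valU hevU [LHS]free_map_fmon.
Qed.

Definition rel_index : choiceType := ('I_r.+1 * I)%type.
Definition rel_deg (j : rel_index) : int := (size (tword [:: j.1]))%:Z + hdeg j.2.
Notation gens1 := (freemod k r rel_deg).

(** The relation [t_a[i] = [t_a i]] between generators, where an element of [M] is
    read as a combination of generators through [sec]. *)
Definition rel_val (j : rel_index) : gens0 :=
  tact [:: j.1] (gen_val << j.2 >>) - gen_val (sec (tact [:: j.1] (hval j.2))).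

Lemma rel_val_deg j : part (rel_deg j) (rel_val j) = rel_val j.
Proof.
rewrite partD partN part_act !gen_val_part malg_partU eqxx sec_deg //.
by rewrite part_act hval_deg.
Qed.

Definition delta : gens1 -> gens0 := free_map rel_val.

Lemma deltaD (u v : gens1) : delta (u + v) = delta u + delta v. Proof. exact: free_mapD. Qed.

Lemma delta0 : delta 0 = 0. Proof. exact: free_map0. Qed.

Lemma delta_act (w : seq (fg_index B)) (u : gens1) : delta (wact w u) = wact w (delta u).
Proof. exact: (free_map_act rel_val_deg). Qed.

Lemma delta_rel : is_grel (fun x u => delta x = u).
Proof. exact: (free_map_rel rel_val_deg). Qed.

Lemma delta_fmon c b t j :
  delta (fmon rel_deg c (b, t, j)) = c%:A *: yact b t (rel_val j).
Proof. exact: free_map_fmon. Qed.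

Lemma eps_relation (w : seq (fg_index B)) v m :
  eps (wact w (gen_val v) - gen_val (sec m)) = wact w (hev v) - m.
Proof. by rewrite epsB eps_act !eps_gen secK. Qed.

Lemma eps_rel_val j : eps (rel_val j) = 0.
Proof.
apply: (etrans (eps_relation _ _ _)).
have -> : hev << j.2 >> = hval j.2 by rewrite hevU scal1k.
exact: subrr.
Qed.

Lemma eps_delta x : eps (delta x) = 0.
Proof.
apply: (freemod_additive_eq (f := fun x => eps (delta x)) (g := fun=> 0)).
- by move=> u w; rewrite deltaD epsD.
- by move=> u w; rewrite addr0.
move=> c [[b t] [a i]]; rewrite delta_fmon.
by rewrite eps_scal eps_act eps_rel_val act0 scaler0.
Qed.

Lemma sub_act_closed (R : gens0 -> Prop) (gR : is_gsub R) (w : seq (fg_index B)) (u v : gens0) :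
  R (u - v) -> R (wact w u - wact w v).
Proof. by rewrite -actB; apply: gsub_act. Qed.

Definition in_delta (u : gens0) : Prop := exists x, delta x = u.

Lemma in_delta_gsub : is_gsub in_delta.
Proof. exact: (range_gsub (qfun delta_rel)). Qed.

(** Modulo the relations, [t_a] maps combinations of generators to combinations
    of generators. *)
Lemma letter_reduction a v :
  in_delta (tact [:: a] (gen_val v) - gen_val (sec (tact [:: a] (hev v)))).
Proof.
elim/malg_ind: v => [|u v Hu Hv|c i].
- by rewrite word_val0 hev0 !act0 sec0 word_val0 subrr; apply: (gsub0 in_delta_gsub).
- rewrite word_valD hevD !actD secD word_valD opprD addrACA.
  exact: (gsubD in_delta_gsub Hu Hv).
have ciE : << c *g i >> = c *: << i >> :> {malg k[I]} by rewrite malgZU mulr1.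
have hi : hev << i >> = hval i by rewrite hevU scal1k.
rewrite ciE word_valZ hevZ hi !actZ secZ word_valZ -scalerBr.
by exists (fmon rel_deg c (ord0, [::], (a, i))); rewrite delta_fmon.
Qed.

Lemma tword_reduction s v : s != [::] ->
  in_delta (tact s (gen_val v) - gen_val (sec (tact s (hev v)))).
Proof.
elim: s => // a [|a' s] IH _; first exact: letter_reduction.
set t := a' :: s in IH *; have {}IH := IH isT.
have tE (N : grmod B) (n : N) : tact (a :: t) n = tact [:: a] (tact t n).
  by rewrite -act_cat -tword_cat.
have A := sub_act_closed in_delta_gsub (tword [:: a] : seq (fg_index B)) IH.
have := gsubD in_delta_gsub A (letter_reduction a (sec (tact t (hev v)))).
by rewrite secK addrA subrK -!tE.
Qed.

(** A word that begins with x acts as zero or is a product of factors [t_a], and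
    these can be absorbed into the generators one after the other. *)
Lemma word_reduction (w : seq bool) v :
  in_delta (wact (false :: w : seq (fg_index B)) (gen_val v) - gen_val (sec (wact (false :: w : seq (fg_index B)) (hev v)))).
Proof.
have [w0|[b [s wE]]] := word_normal k r (false :: w).
  by rewrite !w0 sec0 word_val0 subrr; apply: (gsub0 in_delta_gsub).
have b0 : nat_of_ord b = 0%N by case: b wE => -[].
have sn : s != [::] by case: s wE; rewrite /yword b0.
have := tword_reduction v sn; suff -> : tword s = false :: w by [].
by rewrite wE /yword b0.
Qed.

Lemma eps_reduction (w : seq bool) u :
  in_delta (wact (false :: w : seq (fg_index B)) u - gen_val (sec (wact (false :: w : seq (fg_index B)) (eps u)))).
Proof.
elim/freemod_ind: u => [|u v Hu Hv|c [[b t] i]].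
- by rewrite eps0 !act0 sec0 word_val0 subrr; apply: (gsub0 in_delta_gsub).
- rewrite epsD !actD secD word_valD opprD addrACA.
  exact: (gsubD in_delta_gsub Hu Hv).
have -> : fmon hd c (b, t, i) = yact b t (gen_val << c *g i >>).
  by rewrite word_val_act word_valU.
rewrite eps_act eps_gen -!act_cat; exact: word_reduction.
Qed.

(** If [eps u] is torsion then every sufficiently long product [t_a t_s1 ... t_sn]
    sends [u] to an element that is congruent to a combination of generators,
    namely to the one attached to [t_a t_s1 ... t_sn (eps u) = 0]. *)
Lemma eps_exact u : torsel (eps u) -> absorbed in_delta u.
Proof.
move=> [n un]; apply: (absorbed_tword in_delta_gsub (n := n.+1)) => -[//|a s] [sn].
have tE (N : grmod B) (m : N) : tact (a :: s) m =
    wact (false :: nseq a true : seq (fg_index B)) (tact s m).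
  by rewrite -act_cat.
have := eps_reduction (nseq a true) (tact s u).
have -> : eps (tact s u) = 0.
  by rewrite eps_act; apply: (tors_ge (gsub_zero M) _ un erefl); rewrite -sn size_tword_ge.
by rewrite act0 sec0 word_val0 subr0 -tE.
Qed.

Lemma seq_argmax (T : eqType) (f : T -> nat) (x0 : T) (s : seq T) : x0 \in s ->
  exists2 x, x \in s & forall y, y \in s -> (f y <= f x)%N.
Proof.
elim: s x0 => // y s IH x0 _; case: s IH => [|z s] IH.
  by exists y; rewrite ?mem_head // => w; rewrite inE => /eqP->.
have [x xs xmax] := IH z (mem_head _ _).
have [xy|yx] := leqP (f x) (f y).
  exists y; rewrite ?mem_head // => w; rewrite inE => /orP[/eqP-> //|/xmax wx].
  exact: leq_trans wx xy.
exists x; first by rewrite inE xs orbT.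
by move=> w; rewrite inE => /orP[/eqP->|/xmax //]; apply: ltnW.
Qed.

(** A relation multiplied by [y^b t_s1 ... t_sn] has the leading term
    [y^b t_s1 ... t_sn t_a[i]] with n+1 factors, whereas its other terms have n
    factors. The leading terms of different multiples are different. *)
Lemma delta_lead (x : gens1) b s a i :
  (forall y, fcoef y x != 0 -> (size y.1.2 <= size s)%N) ->
  fcoef (b, rcons s a, i) (delta x) = fcoef (b, s, (a, i)) x.
Proof.
move: x; apply: freemod_supp_ind => [|x y Hx Hy|c [[b' s'] [a' i']] /= s's].
- by rewrite delta0 !fcoef0.
- by rewrite deltaD !fcoefD Hx Hy.
have val_rel v m : yact b' s' (tact [:: a'] (gen_val v) - gen_val m) =
    word_val b' (rcons s' a') v - word_val b' s' m.
  by rewrite actB -act_cat -yword_rcons !word_val_act.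
rewrite delta_fmon fcoefZ [rel_val _]/rel_val val_rel fcoefD fcoefN.
(* The subtracted combination only has monomials with [size s'] factors. *)
rewrite [X in _ - X]word_val_coef; last first.
  by apply: contraTneq s's => /= <-; rewrite size_rcons ltnn.
rewrite subr0 word_valU !fcoef_fmon !xpair_eqE /= eqseq_rcons.
by rewrite -!andbA mulrnAr mulr1.
Qed.

Lemma delta_inj x : delta x = 0 -> x = 0.
Proof.
move=> dx0; have [l lP] := fcoef_finite x; apply: fcoef_inj => y.
apply/eqP/negPn/negP; rewrite -lP.
move=> /(seq_argmax (fun z : free_index r rel_index => size z.1.2)).
move=> [[[b s] [a i]] zl zmax].
have lead : fcoef (b, rcons s a, i) (delta x) = fcoef (b, s, (a, i)) x.
  by apply: delta_lead => y'; rewrite -lP => /zmax.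
by move: zl; rewrite lP -lead dx0 fcoef0 eqxx.
Qed.

Lemma free_exact : is_kernel (C := QGr B) (qfun delta_rel) (qfun eps_rel) /\
  is_cokernel (C := QGr B) (qfun eps_rel) (qfun delta_rel).
Proof.
have mono x u : qfun delta_rel x u -> torsel u -> torsel x.
  by move=> <- [n un]; exists n => w /un; rewrite -delta_act => /delta_inj.
have comp0 x u m : qfun delta_rel x u -> qfun eps_rel u m -> torsel m.
  by move=> <- <-; rewrite eps_delta; apply: torsel0.
have exact u m : qfun eps_rel u m -> torsel m ->
    absorbed (fun u' => exists x, qfun delta_rel x u') u.
  by move=> <- /eps_exact.
have epi m : absorbed (fun m' => exists u, qfun eps_rel u m') m.
  by exists 0%N => w _; exists (gen_val (sec (wact w m))); rewrite /= eps_gen secK.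
by split; [apply: exact_kernel | apply: exact_cokernel].
Qed.

End Resolution.

Theorem free_resolution (k : fieldType) (r : nat) (M : grmod (gradedB k r)) :
  exists (J I : choiceType) (jdeg : J -> int) (ideg : I -> int)
    (f : qhom (freemod k r jdeg) (freemod k r ideg)) (g : qhom (freemod k r ideg) M),
  is_kernel (C := QGr (gradedB k r)) f g /\ is_cokernel (C := QGr (gradedB k r)) g f.
Proof.
have [sec [secD secZ sec_deg secK]] := graded_section M.
by do 6!eexists; apply: (free_exact secD secZ sec_deg secK).
Qed.

(** * An extension that does not split *)

Section Nonsplit.
Variables (k : fieldType) (r : nat).
Notation B := (gradedB k r).

Section FreeTorsion.
Variables (I : choiceType) (deg : I -> int).
Notation F := (freemod k r deg).

(** Distinct monomials cannot cancel if their images are distinct monomials. *)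
Lemma monomial_injective (w : seq (fg_index B)) (h : free_index r I -> free_index r I) :
  injective h -> (forall c x, wact w (fmon deg c x) = fmon deg c (h x) :> F) ->
  forall u : F, wact w u = 0 -> u = 0.
Proof.
move=> h_inj wh u wu0; apply: fcoef_inj => x.
suff <- : fcoef (h x) (wact w u) = fcoef x u by rewrite wu0 fcoef0.
apply: (freemod_additive_eq (f := fun u : F => fcoef (h x) (wact w u))).
- by move=> v v'; rewrite actD fcoefD.
- exact: fcoefD.
by move=> c y; rewrite wh !fcoef_fmon (inj_eq h_inj).
Qed.

Lemma x_injective n (u : F) : wact (nseq n false : seq (fg_index B)) u = 0 -> u = 0.
Proof.
elim: n => [//|n IH] nu0; apply: IH.
apply: (@monomial_injective [:: false] (fun x => (ord0, x.1.1 :: x.1.2, x.2))) nu0.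
  by move=> [[b s] i] [[b' s'] i'] [-> -> ->].
by move=> c x; rewrite [LHS]fmon_step.
Qed.

(** This fails for r = 0, where y acts as zero. *)
Lemma yx_injective (u : F) : (1 <= r)%N ->
  wact ([:: true; false] : seq (fg_index B)) u = 0 -> u = 0.
Proof.
move=> r1; pose one : 'I_r.+1 := Ordinal (r1 : (1 < r.+1)%N).
apply: (@monomial_injective _ (fun x => (one, x.1.1 :: x.1.2, x.2))).
  by move=> [[b s] i] [[b' s'] i'] [-> -> ->].
move=> c x; rewrite [LHS]/= fmon_step fmon_step /free_step /=.
by rewrite insubT /=; congr (fmon _ _ (_, _, _)); apply: val_inj.
Qed.

Lemma free_torsel_yx (u : F) : (1 <= r)%N ->
  torsel (wact ([:: true; false] : seq (fg_index B)) u) -> u = 0.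
Proof.
move=> r1 [n u0]; apply: yx_injective => //; apply: (@x_injective n).
by apply: u0; rewrite size_nseq.
Qed.

End FreeTorsion.

(** The module [k[x] = B/By]: a basis vector for each power of x, with y acting as
    zero. *)
Definition line_step (b : bool) (n : nat) : option nat := if b then None else Some n.+1.

Lemma line_deg_step b m n : line_step b m = Some n -> n%:Z = 1 + m%:Z.
Proof. by case: b => //= -[<-]. Qed.

Lemma line_nilp n : iter r.+1 (obind (line_step true)) (Some n) = None.
Proof. by rewrite iterS; case: (iter r _ _). Qed.

Definition line_monact : monact r := MonAct line_deg_step line_nilp.
Definition line : grmod B := monmod k line_monact.

Definition xpow (n : nat) : line := << n >>.

Lemma x_xpow n m : wact (nseq n false : seq (fg_index B)) (xpow m) = xpow (n + m)%N.
Proof.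
elim: n => [//|n IH]; rewrite -[nseq _ _]/(false :: nseq n false) [LHS]/= IH.
by rewrite mon_gen [LHS]mstepU.
Qed.

Lemma yx_xpow n : wact ([:: true; false] : seq (fg_index B)) (xpow n) = 0.
Proof. by rewrite [LHS]/= mon_gen mon_gen [mstep false _]mstepU [LHS]mstepU. Qed.

Lemma xpow_not_torsel n : ~ torsel (xpow n).
Proof.
move=> [l /(_ (nseq l false : seq (fg_index B)))]; rewrite size_nseq x_xpow => /(_ erefl).
by move/eqP; rewrite monalgU_eq0 oner_eq0.
Qed.

(** The elements [x^n] are killed by y x, so a section sends one of them to some
    [u] with [y x u] torsion; then [u] is 0, although [x^n] is not torsion. *)
Lemma line_nonsplit (N : grmod B) (I : choiceType) (deg : I -> int)
    (f : qhom N (freemod k r deg)) (g : qhom (freemod k r deg) line)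
    (kerf : is_kernel (C := QGr B) f g) (cokg : is_cokernel (C := QGr B) g f) :
  (1 <= r)%N -> ~ has_section (Ses kerf cokg).
Proof.
move=> r1 [s /qeq_torselP gs].
have [n sn] := absorbed_dom s (xpow 0).
have [u su] := sn (nseq n false : seq (fg_index B)) (size_nseq _ _).
rewrite x_xpow addn0 in su.
have u0 : u = 0.
  have su' := qhom_act ([:: true; false] : seq (fg_index B)) su.
  rewrite yx_xpow in su'; exact: free_torsel_yx r1 (qhom_indet su').
have gs0 : qcomp g s (xpow n) 0 by exists u => //; rewrite u0; apply: qhom0.
have := gs _ _ (xpow n) gs0 erefl; rewrite sub0r => /torselN.
by rewrite opprK; apply: xpow_not_torsel.
Qed.

End Nonsplit.

Theorem proposition8p4 (k : fieldType) (r : nat) (hr : (1 <= r)%N) :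
  Ext_identically_zero (QGr (gradedB k r)) 2 /\
  ~ Ext_identically_zero (QGr (gradedB k r)) 1.
Proof.
split.
  apply: Ext2_zero => M; have [J [I [jdeg [ideg [f [g [kerf cokg]]]]]]] := free_resolution M.
  exists (freemod k r jdeg), (Ses kerf cokg).
  by split; apply: freemod_projective.
have [J [I [jdeg [ideg [f [g [kerf cokg]]]]]]] := free_resolution (line k r).
exact: (Ext1_nonzero (@line_nonsplit k r _ _ _ f g kerf cokg hr)).
Qed.
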